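(* Let $L_1,\ldots,L_{n+1}$ be mutually commuting partial differential operators in the variables $x_1,\ldots,x_n$, and let $p(\mu_1,\ldots,\mu_{n+1})$ be any $\mu$-shifted differential resultant of the operators $L_i$. Then $$p(L_1,\ldots,L_{n+1})=0.$$
   Context: Let $n\ge1$ and let differential operators be elements of $\mathbb{C}(x_1,\ldots,x_n)[\partial_1,\ldots,\partial_n]$, $\partial_i=\partial/\partial x_i$, with composition $\circ$ as product. For $d\ge 0$, let $\Omega^d=(\omega_1^d,\omega_2^d,\ldots)$ be the $\binom{n+d}{n}$-component vector listing, in some fixed order, all monic monomial operators $\partial_1^{\alpha_1}\cdots\partial_n^{\alpha_n}$ with $\alpha_i\in\mathbb{N}$ (including $0$) and $\sum\alpha_i\le d$. For a differential operator $L$ of order at most $d$, let $\vec{\mathbf{v}}_d(L)$ be the vector whose $i$-th entry is the coefficient of $\omega_i^d$ in $L$ (coefficients written on the left), so $L=\vec{\mathbf{v}}_d(L)\cdot\Omega^d$. Let $L_1,\ldots,L_{n+1}$ be differential operators of orders $l_1,\ldots,l_{n+1}$, let $\mu_1,\ldots,\mu_{n+1}$ be indeterminates commuting with all operators, and put $N=-n+\sum_{i=1}^{n+1} l_i$. Let $R_\mu=R_\mu(L_1,\ldots,L_{n+1})$ be the matrix whose rows are $\vec{\mathbf{v}}_N\big(\omega_j^{N-l_i}\circ(L_i-\mu_i)\big)$ for all $1\le i\le n+1$ and all $1\le j\le\binom{n+N-l_i}{n}$. Any maximal minor determinant of $R_\mu$ is called a partial $\mu$-shifted differential resultant of the $L_i$;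 it is a polynomial in $\mu_1,\ldots,\mu_{n+1}$ with coefficients that may depend on $x_1,\ldots,x_n$. The $\mu$-shifted differential resultant of the operators $L_i$ is the polynomial in the variables $\mu_i$ which is the greatest common divisor of all of these maximal minor determinants (its coefficients may likewise depend on $x_1,\ldots,x_n$). For such a polynomial $p=\sum_\alpha c_\alpha(x)\mu_1^{\alpha_1}\cdots\mu_{n+1}^{\alpha_{n+1}}$, the operator $p(L_1,\ldots,L_{n+1})$ means $\sum_\alpha c_\alpha(x)\,L_1^{\alpha_1}\circ\cdots\circ L_{n+1}^{\alpha_{n+1}}$, with the coefficients on the left.
   Formalization: It is assumed in addition that at most one of the operators L_i has order 0; with two of order 0 the claim fails (n=3, L_1=L_2=1, L_3=∂_1^3, L_4=∂_2^3 give gcd 1) or N<0 and the matrix is undefined. *)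

(* Defs.v *)
From HB Require Import structures.
From mathcomp Require Import all_boot all_order all_algebra.
From mathcomp Require Import fraction.
From mathcomp Require Import mpoly.

Set Implicit Arguments.
Unset Strict Implicit.
Unset Printing Implicit Defensive.

Import GRing.Theory.
Local Open Scope ring_scope.

(* Extension of a derivation d of D to its fraction field by the quotient rule;
   the value does not depend on the representative num / den chosen by repr. *)
Definition fracderiv (D : idomainType) (d : D -> D) (f : {fraction D}) :
    {fraction D} :=
  let num := (frac (repr f)).1 in
  let den := (frac (repr f)).2 in
  FracField.tofrac (d num * den - num * d den) / FracField.tofrac (den ^+ 2).

(* F(x_1, ..., x_n) and d/dx_i *)
Definition ratfun (F : fieldType) (n : nat) : fieldType :=
  {fraction {mpoly F[n]}}.

Definition ratderiv (F : fieldType) (n : nat) (i : 'I_n) :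
    ratfun F n -> ratfun F n :=
  fracderiv (mderiv i).

(* The differential operator \sum_a c_a \partial^a, with coefficients in A on
   the left, is encoded by the polynomial \sum_a c_a 'X_[a] in {mpoly A[n]}.
   The ring product of {mpoly A[n]} is NOT the composition of operators, which
   is dop_comp below. *)
Section DiffOp.
Variables (n : nat) (A : comNzRingType) (der : 'I_n -> A -> A).

(* \partial_i \o P, from \partial_i \o c = c \partial_i + der i c. *)
Definition dop_partial (i : 'I_n) (P : {mpoly A[n]}) : {mpoly A[n]} :=
  'X_i * P + \sum_(a <- msupp P) der i P@_a *: 'X_[a].

(* \partial^a \o P *)
Definition dop_mono (a : 'X_{1..n}) (P : {mpoly A[n]}) : {mpoly A[n]} :=
  foldr (fun i => iter (a i) (dop_partial i)) P (enum 'I_n).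

Definition dop_comp (Q P : {mpoly A[n]}) : {mpoly A[n]} :=
  \sum_(a <- msupp Q) Q@_a *: dop_mono a P.

Definition dop_exp (P : {mpoly A[n]}) (k : nat) : {mpoly A[n]} :=
  iter k (dop_comp P) 1.

(* The zero operator gets order 0. *)
Definition dop_order (P : {mpoly A[n]}) : nat := (msize P).-1.

End DiffOp.

(* 'X_{1..n < d.+1} indexes the monomial operators of order at most d, so that
   this is the coefficient vector v_d(P), of length 'C(n + d, n). *)
Definition dop_vec (n d : nat) (A : comNzRingType) (P : {mpoly A[n]}) :
    'rV[A]_(#|{: 'X_{1..n < d.+1}}|) :=
  \row_j P@_(bmnm (enum_val j)).

(* Extension of derivations der of K to K[mu_1, ..., mu_k], for which the mu_j
   are constants. *)
Definition muderiv (n k : nat) (K : comNzRingType) (der : 'I_n -> K -> K)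
    (i : 'I_n) (c : {mpoly K[k]}) : {mpoly K[k]} :=
  \sum_(m <- msupp c) der i c@_m *: 'X_[m].

Section Resultant.
Variables (n : nat) (K : comNzRingType) (der : 'I_n -> K -> K).
Variable L : 'I_n.+1 -> {mpoly K[n]}.

(* N = l_1 + ... + l_{n+1} - n; the subtraction is not truncated when at most
   one of the orders l_i is 0. *)
Definition res_order : nat := (\sum_(i < n.+1) dop_order (L i) - n)%N.

(* Pairs (i, a) with |a| <= N - l_i; there is none for i when N < l_i, whence
   the bound N.+1 - l_i rather than (N - l_i).+1 with its truncated
   subtraction. *)
Definition res_row : finType :=
  {i : 'I_n.+1 & 'X_{1..n < res_order.+1 - dop_order (L i)}}.

(* L_i - mu_i as an operator over K[mu]. *)
Definition shifted_dop (i : 'I_n.+1) : {mpoly {mpoly K[n.+1]}[n]} :=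
  \sum_(a <- msupp (L i)) ((L i)@_a)%:MP *: 'X_[a] - ('X_i)%:MP.

Definition res_matrix :
    'M[{mpoly K[n.+1]}]_(#|{: res_row}|, #|{: 'X_{1..n < res_order.+1}}|) :=
  \matrix_r
    dop_vec res_order
      (dop_comp (muderiv der)
         'X_[bmnm (tagged (enum_val r))] (shifted_dop (tag (enum_val r)))).

End Resultant.

Definition maximal_minor (A : comNzRingType) (r c : nat) (M : 'M[A]_(r, c))
    (d : A) : Prop :=
  exists (f : 'I_(minn r c) -> 'I_r) (g : 'I_(minn r c) -> 'I_c),
    [/\ {homo f : i j / (i < j)%N}, {homo g : i j / (i < j)%N}
      & d = \det (mxsub f g M)].

Definition divides (A : comNzRingType) (a b : A) : Prop :=
  exists q, b = q * a.

Definition is_gcd (A : comNzRingType) (S : A -> Prop) (g : A) : Prop :=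
  (forall a, S a -> divides g a) /\
  (forall d, (forall a, S a -> divides d a) -> divides d g).

(* The gcd is defined up to a unit of K[mu], hence a predicate. *)
Definition mu_shifted_resultant (n : nat) (K : comNzRingType)
    (der : 'I_n -> K -> K) (L : 'I_n.+1 -> {mpoly K[n]})
    (p : {mpoly K[n.+1]}) : Prop :=
  is_gcd (maximal_minor (res_matrix der L)) p.

(* p(L_1, ..., L_k), with the coefficients of p on the left. *)
Definition dop_eval (n k : nat) (K : comNzRingType) (der : 'I_n -> K -> K)
    (p : {mpoly K[k]}) (L : 'I_k -> {mpoly K[n]}) : {mpoly K[n]} :=
  \sum_(m <- msupp p)
    p@_m *: \big[dop_comp der/1]_(i < k) dop_exp der (L i) (m i).

(* Main.v *)
Require Import Defs.
From mathcomp Require Import all_boot all_order all_algebra.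
From mathcomp Require Import fraction mpoly reals complex.
From mathcomp Require Import ring zify ssrcomplements boolp.

Set Implicit Arguments.
Unset Strict Implicit.
Unset Printing Implicit Defensive.

Import GRing.Theory.
Local Open Scope ring_scope.

(** Let [K] be the field of rational functions and let the polynomials in the
    [mu_i] over [K] act on differential operators: scalars multiply on the left
    and [mu_i] composes with [L i] on the right ([dop_act]). As the [L i]
    commute, this is a module structure, in which [p(L)] is the image of the
    operator [1] under [p].

    Each maximal minor [d] annihilates [1]. There are at least as many rows as
    columns ([res_matrix_cols_leq]), so by Cramer's rule the operator [d] is a
    combination of the rows; it lies in the left ideal generated by the
    [L i - mu_i], and this ideal acts as zero ([maximal_minor_act]).

    The difficulty is to pass from the minors to their gcd [p], since [K[mu]]
    is not principal: writing [d = q * p], one knows only that [p(L)] is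
    annihilated by all cofactors [q], which have no common prime factor. The
    answer depends on the symbols [sigma_i] (leading forms) of the [L i]; let
    [N] be the order of the resultant matrix.

    - The [sigma_i] of positive degree may generate all forms of degree [N].
      Then the polynomials in the variables [xi] are finitely generated over
      the polynomials in the [sigma_i] ([spanned_monomial]). Symbols being
      multiplicative, for every operator [e <> 0] the products of [e] with at
      most [m] of the [L i] span a space of dimension at least a constant times
      [m ^ n] ([rank_span_geq], [rank_symbols_leq]). If [p(L) <> 0], unique
      factorization ([factorial_mpoly]) provides a multiple [e <> 0] of [p(L)]
      annihilated by a prime and by some cofactor which that prime does not
      divide. But [K[mu]] has [n + 1] variables, and its quotient by two such
      polynomials has dimension only of the order of [m ^ (n - 1)] in degree
      at most [m] ([rank_coprime_quotient]), a contradiction.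

    - Otherwise the columns of degree [N] satisfy a linear relation over [K] on
      all rows that come from operators of positive order, because the entries
      of these rows in degree [N] are free of [mu]. If all orders are positive,
      every maximal minor vanishes and [p = 0]. If [L i] has order zero, it is
      the only one and [L i - mu_i], which annihilates [1], divides every
      maximal minor, hence [p] ([symbols_fill_or_divides]). *)

(** * Unique factorization in polynomial rings *)

Section Divides.
Variable R : idomainType.
Implicit Types a b c p : R.

Lemma divides_refl a : divides a a.
Proof. by exists 1; rewrite mul1r. Qed.

Lemma divides0 a : divides a 0.
Proof. by exists 0; rewrite mul0r. Qed.


Lemma divides_mull a b c : divides a b -> divides a (c * b).
Proof. by case=> u ->; exists (c * u); rewrite mulrA. Qed.

Lemma divides_mulr a b c : divides a b -> divides a (b * c).
Proof. by rewrite mulrC; apply: divides_mull. Qed.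

Lemma dividesD a b c : divides a b -> divides a c -> divides a (b + c).
Proof. by case=> u -> [v ->]; exists (u + v); rewrite mulrDl. Qed.

Lemma dividesN a b : divides a b -> divides a (- b).
Proof. by case=> u ->; exists (- u); rewrite mulNr. Qed.

Lemma dividesB a b c : divides a b -> divides a c -> divides a (b - c).
Proof. by move=> ab ac; apply: dividesD => //; apply: dividesN. Qed.

Lemma divides_sum (I : Type) (r : seq I) (P : pred I) (F : I -> R) a :
  (forall i, P i -> divides a (F i)) -> divides a (\sum_(i <- r | P i) F i).
Proof.
move=> h; apply: (big_ind (divides a)) => //; first exact: divides0.
by move=> *; apply: dividesD.
Qed.

Lemma unit_divides a b : divides a b -> b \is a GRing.unit -> a \is a GRing.unit.
Proof. by case=> u ->; rewrite unitrM => /andP[]. Qed.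

Definition prime_elt p :=
  [/\ p != 0, p \isn't a GRing.unit
    & forall a b, divides p (a * b) -> divides p a \/ divides p b].

Definition prime_factors (s : seq R) a :=
  (forall p, p \in s -> prime_elt p) /\
  exists2 u, u \is a GRing.unit & a = u * \prod_(p <- s) p.

Definition factorial := forall a, a != 0 -> exists s, prime_factors s a.

(** A prime dividing [a] is, up to a unit, one of the listed factors, so that
    dividing by it shortens the list: this is what inductions on the number of
    prime factors need. *)
Lemma prime_factors_div s p a b :
  prime_factors s a -> prime_elt p -> a = p * b ->
  exists2 s', prime_factors s' b & (size s = (size s').+1)%N.
Proof.
move=> [sP [u uu ->]] pP; move: (pP) => [p0 pu pM].
elim: s u uu b sP => [|q s IHs] u uu b sP.
  rewrite big_nil mulr1 => e; case/negP: pu.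
  by apply: unit_divides uu; exists b; rewrite mulrC.
rewrite big_cons => e.
have [q0 qu qM] : prime_elt q by apply: sP; rewrite mem_head.
have sP' r : r \in s -> prime_elt r by move=> rs; apply: sP; rewrite inE rs orbT.
have : divides p (q * (u * \prod_(j <- s) j)).
  by exists b; rewrite [RHS]mulrC -e mulrCA.
case/pM => [[v qE] | [c cE]].
  have : divides q (v * p) by rewrite -qE; apply: divides_refl.
  case/qM => [[w vE] | [w pE]].
    case/negP: pu; apply/unitrPr; exists w.
    by apply: (mulfI q0); rewrite mulr1 {2}qE vE; ring.
  have vw : v * w = 1 by apply: (mulIf q0); rewrite mul1r -mulrA -pE -qE.
  exists s => //; split=> //; exists (u * v).
    by rewrite unitrM uu /=; apply/unitrPr; exists w.
  by apply: (mulfI p0); rewrite -e qE; ring.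
have [s' [s'P [w wu cE']] sz] := IHs u uu c sP' (etrans cE (mulrC _ _)).
exists (q :: s'); last by rewrite /= sz.
split; first by move=> r; rewrite inE => /orP[/eqP -> | /s'P].
exists w => //; apply: (mulfI p0); rewrite -e mulrCA cE cE' big_cons.
by ring.
Qed.
End Divides.

Section Gauss.
Variable R : idomainType.
Implicit Types (p r : R) (f g h : {poly R}).


(** Were [f] and [g] not divisible by [p], removing the leading terms that are
    divisible would leave a product divisible by [p] whose leading coefficient is
    not. *)
Lemma prime_elt_polyC p : prime_elt p -> prime_elt p%:P.
Proof.
move=> [p0 pu pM]; split; first by rewrite polyC_eq0.
  by apply: contra pu; rewrite poly_unitE size_polyC p0 coefC.
have div_coef f : divides p%:P f -> divides p (lead_coef f).
  by case=> u ->; rewrite lead_coefM lead_coefC; exists (lead_coef u).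
have drop f g : divides p (lead_coef f) -> divides p%:P (f * g) ->
    let f' := f - (lead_coef f)%:P * 'X^((size f).-1) in
    divides p%:P (f' * g) /\ (divides p%:P f' -> divides p%:P f).
  move=> [u lcE] fg f'.
  have fE : f = f' + p%:P * (u%:P * 'X^((size f).-1)).
    rewrite /f' lcE polyCM; ring.
  split; last first.
    by move=> pf'; rewrite fE; apply: dividesD => //; apply/divides_mulr/divides_refl.
  have -> : f' * g = f * g - p%:P * (u%:P * 'X^((size f).-1) * g).
    by rewrite [X in X * g - _]fE; ring.
  by apply: dividesB => //; apply/divides_mulr/divides_refl.
have drop_size f : f != 0 ->
    (size (f - (lead_coef f)%:P * 'X^((size f).-1))%R < size f)%N.
  move=> f0; rewrite -(prednK (_ : 0 < size f)%N) ?size_poly_gt0 // ltnS.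
  apply/leq_sizeP => j; rewrite leq_eqVlt => /orP[/eqP <-|lt].
    by rewrite coefB coefCM coefXn eqxx mulr1 lead_coefE subrr.
  rewrite coefB coefCM coefXn gtn_eqF // mulr0 subr0 nth_default //.
  by rewrite -[size f]prednK ?size_poly_gt0.
suff main k f g : (size f + size g < k)%N -> divides p%:P (f * g) ->
    divides p%:P f \/ divides p%:P g by move=> f g; apply: (main (size f + size g).+1).
elim: k f g => // k IHk f g; rewrite ltnS => szk fg.
have [->|f0] := eqVneq f 0; first by left; apply: divides0.
have [->|g0] := eqVneq g 0; first by right; apply: divides0.
have := div_coef _ fg; rewrite lead_coefM => /pM [pf|pg].
  have [fg' back] := drop _ _ pf fg.
  case: (IHk _ _ _ fg') => [||]; last by right.
    by apply: leq_trans szk; rewrite ltn_add2r drop_size.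
  by move/back; left.
rewrite mulrC in fg; have [fg' back] := drop _ _ pg fg.
rewrite mulrC in fg'.
case: (IHk _ _ _ fg') => [||]; last by move/back; right.
  by apply: leq_trans szk; rewrite ltn_add2l drop_size.
by left.
Qed.

Definition primitive_poly f := forall p, prime_elt p -> ~ divides p%:P f.

(** Clearing denominators is harmless for primitive divisors: a prime of the
    constant [r] divides the product [g * h], and cannot divide [g]. *)
Lemma primitive_poly_cancel r f g h : factorial R -> r != 0 ->
  primitive_poly g -> r%:P * f = g * h -> divides g f.
Proof.
move=> factR r0 gP; have [s [sP [u uu rE]]] := factR _ r0.
elim: s r h r0 sP rE => [|p s IHs] r h r0 sP rE e.
  exists (u^-1%:P * h); rewrite -mulrA [h * g]mulrC -e rE big_nil mulr1.
  by rewrite mulrA -polyCM mulVr // mul1r.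
have pP : prime_elt p by apply: sP; rewrite mem_head.
have p0 : p != 0 by case: pP.
have [_ _ pM] := prime_elt_polyC pP.
have sP' q : q \in s -> prime_elt q by move=> qs; apply: sP; rewrite inE qs orbT.
have rE' : r%:P = p%:P * (u * \prod_(q <- s) q)%:P.
  by rewrite rE big_cons -polyCM; congr _%:P; ring.
have : divides p%:P (g * h) by rewrite -e rE'; exists ((u * \prod_(q <- s) q)%:P * f); ring.
case/pM => [pg|[h' hE]]; first by case: (gP p).
apply: (IHs (u * \prod_(q <- s) q) h') => //.
  by apply: contraNneq r0 => z; rewrite rE big_cons mulrCA z mulr0.
apply: (mulfI (_ : p%:P != 0)); first by rewrite polyC_eq0.
by rewrite mulrA -rE' e hE; ring.
Qed.

(** Prime constants can be divided out only finitely often, since each of them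
    uses up a prime factor of the leading coefficient. *)
Lemma primitive_part f : factorial R -> f != 0 ->
  exists c g, [/\ c != 0, primitive_poly g & f = c%:P * g].
Proof.
move=> factR f0.
have lf0 : lead_coef f != 0 by rewrite lead_coef_eq0.
have [s] := factR _ lf0; move szs: (size s) => k.
elim: k s f f0 lf0 szs => [|k IHk] s f f0 lf0 szs lfP.
  exists 1, f; split; rewrite ?oner_eq0 ?mul1r // => p pP [g fE].
  move: lfP; rewrite fE lead_coefM lead_coefC mulrC => lfP.
  by have [s' _] := prime_factors_div lfP pP erefl; rewrite szs.
have [[p pP [g fE]]|nP] := EM (exists2 p, prime_elt p & divides p%:P f); last first.
  by exists 1, f; split; rewrite ?oner_eq0 ?mul1r // => p pP pf; apply: nP; exists p.
move: lfP; rewrite fE lead_coefM lead_coefC mulrC => lfP.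
have [s' s'P] := prime_factors_div lfP pP erefl; rewrite szs => -[/esym szs'].
have g0 : g != 0 by apply: contraNneq f0 => z; rewrite fE z mul0r.
have [|c [h [c0 hP gE]]] := IHk s' g g0 _ szs' s'P; first by rewrite lead_coef_eq0.
exists (p * c), h; split=> //; first by rewrite mulf_neq0 //; case: pP.
by rewrite gE polyCM; ring.
Qed.

Lemma prime_factors_mul s t (a b : {poly R}) :
  prime_factors s a -> prime_factors t b -> prime_factors (s ++ t) (a * b).
Proof.
move=> [sP [u uu ->]] [tP [v vv ->]]; split.
  by move=> p; rewrite mem_cat => /orP[/sP|/tP].
by exists (u * v); rewrite ?unitrM ?uu // big_cat /=; ring.
Qed.

(** Gauss's lemma. A primitive polynomial without proper factor of positive
    degree over the fraction field is prime: a gcd argument there gives a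
    divisibility up to a constant, which [primitive_poly_cancel] removes. *)
Lemma factorial_poly : factorial R -> factorial {poly R}.
Proof.
move=> factR f; move: {2}(size f).+1 (ltnSn (size f)) => k.
elim: k f => // k IHk f; rewrite ltnS => szk f0.
have constP (c : R) : c != 0 -> exists s, prime_factors s c%:P.
  move=> c0; have [s [sP [u uu cE]]] := factR _ c0.
  exists [seq p%:P | p <- s]; split.
    by move=> q /mapP[p ps ->]; apply/prime_elt_polyC/sP.
  exists u%:P; first exact: rmorph_unit.
  by rewrite big_map cE polyCM rmorph_prod.
have [c [g [c0 gP fE]]] := primitive_part factR f0.
have [s sc] := constP c c0.
suff [t tg] : exists t, prime_factors t g.
  by exists (s ++ t); rewrite fE; apply: prime_factors_mul.
have g0 : g != 0 by apply: contraNneq f0 => z; rewrite fE z mulr0.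
have szg : size g = size f by rewrite fE mul_polyC size_scale.
have [sz1|sz1] := leqP (size g) 1.
  by move: g0; rewrite (size1_polyC sz1) polyC_eq0; apply: constP.
have [[h [hg h1 hsz]]|irr] := EM (exists h, [/\ h %| g, (1 < size h)%N & (size h < size g)%N]).
  have h0 : h != 0 by rewrite -size_poly_gt0 (leq_trans _ h1).
  have [c' [h' [c'0 h'P hE]]] := primitive_part factR h0.
  have szh : size h' = size h by rewrite hE mul_polyC size_scale.
  move: hg; rewrite Pdiv.Idomain.dvdp_eq => /eqP; set r := lead_coef h ^+ _.
  rewrite hE -mul_polyC => ge.
  have r0 : r != 0 by rewrite expf_neq0 ?lead_coef_eq0.
  have [|q gE] := @primitive_poly_cancel r g h' ((g %/ h) * c'%:P) factR r0 h'P.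
    by rewrite ge -hE; rewrite {2}hE; ring.
  have q0 : q != 0 by apply: contraNneq g0 => z; rewrite gE z mul0r.
  have h'0 : h' != 0 by rewrite -size_poly_gt0 szh size_poly_gt0.
  have szq : (size q < size g)%N.
    move: h1; rewrite gE size_mul // szh; case: (size h) => [|[|m]] // _.
    by rewrite !addnS /= ltnS leq_addr.
  have [s1 s1P] := IHk q (leq_trans szq (leq_trans (eq_leq szg) szk)) q0.
  have [s2 s2P] : exists s, prime_factors s h'.
    by apply: IHk => //; rewrite szh (leq_trans hsz) // szg.
  by exists (s1 ++ s2); rewrite gE; apply: prime_factors_mul.
have true_div a : g %| a -> divides g a.
  rewrite Pdiv.Idomain.dvdp_eq => /eqP; set r := lead_coef g ^+ _ => e.
  apply: (@primitive_poly_cancel r a g (a %/ g)) => //.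
    by rewrite expf_neq0 ?lead_coef_eq0.
  by rewrite mul_polyC e mulrC.
exists [:: g]; split; last by exists 1; rewrite ?unitr1 // big_seq1 mul1r.
move=> p; rewrite inE => /eqP ->; split=> //.
  by rewrite poly_unitE; case: eqP sz1 => // ->.
move=> a b [q abE].
have gab : g %| a * b.
  by rewrite abE dvdp_mulIr.
have [cop|ncop] := boolP (coprimep g a).
  by right; apply: true_div; rewrite -(Gauss_dvdpr _ cop).
left; apply: true_div.
have dg := dvdp_gcdl g a.
have szd : size (gcdp g a) = size g.
  apply/eqP; rewrite eqn_leq dvdp_leq //= leqNgt; apply/negP => lt.
  case: irr; exists (gcdp g a); split=> //.
  rewrite ltn_neqAle eq_sym size_poly_gt0 gcdp_eq0 (negPf g0) andbT.
  by move: ncop; rewrite /coprimep.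
rewrite -(eqp_dvdl _ (_ : gcdp g a %= g)) ?dvdp_gcdr //.
by rewrite -dvdp_size_eqp // szd.
Qed.
End Gauss.

Section Transport.
Variables (R S : idomainType) (f : {rmorphism R -> S}) (g : S -> R).
Hypotheses (fK : cancel f g) (gK : cancel g f).

Lemma factorial_iso : factorial S -> factorial R.
Proof.
have gM a b : g (a * b) = g a * g b by apply: (can_inj fK); rewrite rmorphM /= !gK.
have g1 : g 1 = 1 by apply: (can_inj fK); rewrite rmorph1 gK.
have g0 : g 0 = 0 by apply: (can_inj fK); rewrite rmorph0 gK.
have gU a : a \is a GRing.unit -> g a \is a GRing.unit.
  by case/unitrPr=> b ab; apply/unitrPr; exists (g b); rewrite -gM ab.
have divE a b : divides (f a) (f b) -> divides a b.
  by case=> q /(congr1 g); rewrite gM !fK => ->; exists (g q).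
move=> factS a a0.
have [|s [sP [u uu aE]]] := factS (f a).
  by apply: contraNneq a0 => e; rewrite -[a]fK e g0.
exists [seq g p | p <- s]; split; last first.
  exists (g u); first exact: gU.
  rewrite -[a]fK aE gM; congr (_ * _).
  by rewrite big_map; apply: (big_morph g).
move=> _ /mapP[p /sP[p0 pu pM] ->]; split.
- by apply: contraNneq p0 => e; rewrite -[p]gK e rmorph0.
- by apply: contra pu => gu; rewrite -[p]gK rmorph_unit.
move=> b c [q bcE]; case: (pM (f b) (f c)) => [|h|h].
- by rewrite -rmorphM bcE rmorphM /= gK; exists (f q).
- by left; apply: divE; rewrite gK.
- by right; apply: divE; rewrite gK.
Qed.
End Transport.

Lemma factorial_field (F : fieldType) : factorial F.
Proof.
by move=> a a0; exists [::]; split=> //; exists a; rewrite ?unitfE // big_nil mulr1.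
Qed.

Section MpolyFactorial.
Variables (K : fieldType) (k : nat).
Implicit Type q : {poly {mpoly K[k]}}.

Lemma muniX (m : 'X_{1..k.+1}) : muni ('X_[m] : {mpoly K[k.+1]}) =
  'X_[[multinom m (widen_ord (leqnSn k) i) | i < k]] *: 'X^(m ord_max).
Proof. by rewrite muniE msuppX big_seq1 mcoeffX eqxx scale1r. Qed.

Lemma muni_mwiden (c : {mpoly K[k]}) : muni (mwiden c) = c%:P.
Proof.
elim/mpolyind: c => [|a m c _ _ IHc]; first by rewrite mwiden0 muni0.
rewrite mwidenD muniD IHc polyCD; congr (_ + _).
rewrite mwidenZ muniZ mwidenX muniX mnmwiden_ordmax expr0 alg_polyC.
rewrite -mul_mpolyC polyCM -mul_polyC; congr (_ * 'X_[_]%:P).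
by apply/mnmP => i; rewrite mnmE mnmwiden_widen.
Qed.

Definition muni_inv q : {mpoly K[k.+1]} := (map_poly (@mwiden k K) q).['X_ord_max].

Lemma muni_invD : {morph muni_inv : p q / p + q}.
Proof. by move=> p q; rewrite /muni_inv rmorphD hornerD. Qed.

Lemma muniK : cancel (@muni k K) muni_inv.
Proof.
elim/mpolyind => [|c m p _ _ IHp]; first by rewrite muni0 /muni_inv rmorph0 horner0.
rewrite (muniD (c *: 'X_[m]) p) (muni_invD (muni (c *: 'X_[m])) (muni p)).
congr (_ + _); last exact: IHp.
rewrite muniZ muniX /muni_inv scalerA -mul_polyC rmorphM /= map_polyC map_polyXn /=.
rewrite hornerM hornerC hornerXn mwidenM mwidenC -mulrA -mul_mpolyC; congr (_ * _).
rewrite mwidenX mpolyXn -mpolyXD; congr 'X_[_]; apply/mnmP => i.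
rewrite mnmDE mulmnE mnm1E eq_sym.
have [->|ni] := eqVneq i ord_max; first by rewrite mnmwiden_ordmax mul1n.
have lti : (i < k)%N.
  by move: (ltn_ord i); rewrite ltnS leq_eqVlt => /orP[/eqP e|//]; case/eqP: ni; apply/val_inj.
have -> : i = widen_ord (leqnSn k) (Ordinal lti) by apply/val_inj.
by rewrite mnmwiden_widen mnmE mul0n addn0.
Qed.

Lemma muni_invK : cancel muni_inv (@muni k K).
Proof.
elim/poly_ind => [|q c IHq]; first by rewrite /muni_inv rmorph0 horner0 muni0.
rewrite /muni_inv rmorphD rmorphM /= map_polyX map_polyC hornerMXaddC.
rewrite -/(muni_inv q) (muniD (muni_inv q * 'X_ord_max) (mwiden c)).
rewrite (muniM (muni_inv q)) IHq muni_mwiden muniX mnm1E eqxx.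
rewrite (_ : [multinom _ | i < k] = 0%MM) ?mpolyX0 ?scale1r //.
apply/mnmP => i; rewrite mnmE mnm1E mnm0E; case: eqP => // /(congr1 val) /= e.
by move: (ltn_ord i); rewrite -e ltnn.
Qed.
End MpolyFactorial.

Lemma factorial_mpoly (K : fieldType) k : factorial {mpoly K[k]}.
Proof.
elim: k => [|k IHk].
  have h0 : cancel (@mcoeff 0 K 0%MM) (@mpolyC 0 K).
    by move=> p; rewrite -nvar0_mpolyC.
  exact: (factorial_iso h0 (@mpolyCK 0 K) (@factorial_field K)).
exact: (factorial_iso (@muniK K k) (@muni_invK K k) (factorial_poly IHk)).
Qed.

(** * Derivations of fields of fractions *)

Section FractionDerivation.
Variable D : idomainType.
Local Notation "x %:F" := (FracField.tofrac x).
Implicit Types (a b : D) (f g : {fraction D}).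

Lemma fraction_repr f : f = (frac (repr f)).1%:F / (frac (repr f)).2%:F.
Proof.
have d0 := denom_ratioP (repr f).
apply: (mulIf (_ : (frac (repr f)).2%:F != 0)); first by rewrite tofrac_eq0.
rewrite divfK ?tofrac_eq0 //.
rewrite -{1}[f]reprK; case: (repr f) d0 => -[x y] /= y0 _.
unlock FracField.tofrac; rewrite -[LHS]FracField.pi_mul.
apply/eqmodP; rewrite /= FracField.equivfE /FracField.mulf /=.
by rewrite !numden_Ratio ?mulf_neq0 ?oner_eq0 //=; apply/eqP; ring.
Qed.

Lemma fractionP f : exists a b, b != 0 /\ f = a%:F / b%:F.
Proof.
exists (frac (repr f)).1, (frac (repr f)).2.
by split; [apply: denom_ratioP | apply: fraction_repr].
Qed.

Section OneDerivation.
Variable d : D -> D.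
Hypotheses (dD : {morph d : a b / a + b})
  (dM : forall a b, d (a * b) = d a * b + a * d b).

(** The quotient rule may be applied to any representative: differentiate the
    equality of cross products. *)
Lemma fracderiv_div a b : b != 0 ->
  fracderiv d (a%:F / b%:F) = (d a * b - a * d b)%:F / (b ^+ 2)%:F.
Proof.
move=> b0; set f := a%:F / b%:F; rewrite /fracderiv.
have d0 := denom_ratioP (repr f); have fE := fraction_repr f.
move: (frac (repr f)).1 (frac (repr f)).2 d0 fE => x y y0 fE.
have /eqP : x%:F * b%:F == a%:F * y%:F.
  by rewrite -eqr_div ?tofrac_eq0 // -fE.
rewrite -!tofracM => /eqP; rewrite tofrac_eq => /eqP e.
have := congr1 d e; rewrite !dM => e'.
apply/eqP; rewrite eqr_div ?tofrac_eq0 ?expf_neq0 // -!tofracM tofrac_eq; apply/eqP.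
have -> : (d x * y - x * d y) * b ^+ 2 =
   (d x * b + x * d b) * (y * b) - x * b * (d b * y + d y * b) by ring.
by rewrite e' e; ring.
Qed.

(** The Leibniz rule for [f * b = a], in which no quotient occurs: sums and
    products are then handled over a common denominator. *)
Lemma fracderivP f a b : b != 0 -> f * b%:F = a%:F ->
  fracderiv d f * b%:F = (d a)%:F - f * (d b)%:F.
Proof.
move=> b0 fb; have b0F : b%:F != 0 by rewrite tofrac_eq0.
have -> : f = a%:F / b%:F by rewrite -fb mulfK.
rewrite fracderiv_div // tofracXn tofracB !tofracM.
apply: (mulIf b0F).
have -> : forall u v w : {fraction D}, u / v * w * w = u / v * w ^+ 2.
  by move=> u v w; rewrite -mulrA.
rewrite divfK ?expf_neq0 // mulrBl; congr (_ - _).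
by rewrite mulrAC divfK.
Qed.

Lemma fracderivD : {morph fracderiv d : f g / f + g}.
Proof.
move=> f g; have [x [y [y0 fE]]] := fractionP f; have [x' [y' [y'0 gE]]] := fractionP g.
have B0 : y * y' != 0 by rewrite mulf_neq0.
have fB : f * (y * y')%:F = (x * y')%:F.
  by rewrite !tofracM mulrA fE divfK // tofrac_eq0.
have gB : g * (y * y')%:F = (x' * y)%:F.
  by rewrite !tofracM mulrCA mulrC gE divfK // tofrac_eq0.
have fgB : (f + g) * (y * y')%:F = (x * y' + x' * y)%:F by rewrite mulrDl fB gB tofracD.
apply: (mulIf (_ : (y * y')%:F != 0)); first by rewrite tofrac_eq0.
rewrite mulrDl (fracderivP B0 fB) (fracderivP B0 gB) (fracderivP B0 fgB).
by rewrite dD tofracD mulrDl opprD addrACA.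
Qed.

Lemma fracderivM f g : fracderiv d (f * g) = fracderiv d f * g + f * fracderiv d g.
Proof.
have [x [y [y0 fE]]] := fractionP f; have [x' [y' [y'0 gE]]] := fractionP g.
have fy : f * y%:F = x%:F by rewrite fE divfK // tofrac_eq0.
have gy : g * y'%:F = x'%:F by rewrite gE divfK // tofrac_eq0.
have fgB : (f * g) * (y * y')%:F = (x * x')%:F by rewrite !tofracM mulrACA fy gy.
apply: (mulIf (_ : (y * y')%:F != 0)); first by rewrite tofrac_eq0 mulf_neq0.
have dfy := fracderivP y0 fy; have dgy := fracderivP y'0 gy.
rewrite (fracderivP _ fgB) ?mulf_neq0 // !dM !tofracD !tofracM -fy -gy.
move: dfy dgy => /(canLR (subrK _)) <- /(canLR (subrK _)) <-.
by ring.
Qed.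
End OneDerivation.

(** The commutator of the two extensions is a derivation that vanishes on [D]. *)
Lemma fracderivC (d e : D -> D) :
  {morph d : a b / a + b} -> {morph e : a b / a + b} ->
  (forall a b, d (a * b) = d a * b + a * d b) ->
  (forall a b, e (a * b) = e a * b + a * e b) ->
  (forall a, d (e a) = e (d a)) ->
  forall f, fracderiv d (fracderiv e f) = fracderiv e (fracderiv d f).
Proof.
move=> dD eD dM eM de f.
pose h g := fracderiv d (fracderiv e g) - fracderiv e (fracderiv d g).
have hM g k : h (g * k) = h g * k + g * h k.
  by rewrite /h !fracderivM // !fracderivD // !fracderivM //; ring.
have tof (k : D -> D) a : {morph k : a b / a + b} ->
    (forall a b, k (a * b) = k a * b + a * k b) -> fracderiv k a%:F = (k a)%:F.
  move=> kD kM; have k1 : k 1 = 0.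
    by apply: (addrI (k 1)); rewrite addr0 -[in RHS](mulr1 1) kM mulr1 mul1r.
  have := fracderiv_div kM a (oner_neq0 D).
  by rewrite tofrac1 divr1 k1 mulr1 mulr0 subr0 expr1n tofrac1 divr1.
have h0 a : h a%:F = 0 by rewrite /h !tof // de subrr.
have [x [y [y0 fE]]] := fractionP f.
have := h0 x; have -> : x%:F = f * y%:F by rewrite fE divfK // tofrac_eq0.
rewrite hM h0 mulr0 addr0 => /eqP; rewrite mulf_eq0 tofrac_eq0 (negPf y0) orbF.
by rewrite subr_eq0 => /eqP.
Qed.
End FractionDerivation.

Section RatDeriv.
Variables (F : fieldType) (n : nat).

Lemma ratderivD i : {morph @ratderiv F n i : f g / f + g}.
Proof. by apply: fracderivD => [p q|p q]; rewrite ?mderivD ?mderivM. Qed.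

Lemma ratderivM i (f g : ratfun F n) :
  ratderiv i (f * g) = ratderiv i f * g + f * ratderiv i g.
Proof. by apply: fracderivM => p q; rewrite mderivM. Qed.

Lemma ratderivC i j (f : ratfun F n) :
  ratderiv i (ratderiv j f) = ratderiv j (ratderiv i f).
Proof.
apply: fracderivC => [p q|p q|p q|p q|p]; rewrite ?mderivD ?mderivM //.
exact: mderiv_comm.
Qed.
End RatDeriv.

(** * Composition of differential operators *)

(** The composition of operators, the extension of derivations to [mu] and the
    action of the polynomials in [mu] are all sums over a support. *)
Section SupportSums.
Variables (k : nat) (A : comNzRingType) (V : zmodType).
Variable F : A -> 'X_{1..k} -> V.
Hypothesis FD : forall m, {morph F^~ m : a b / a + b}.

Let F0 m : F 0 m = 0.
Proof. by apply: (addrI (F 0 m)); rewrite -FD !addr0. Qed.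

Definition supp_sum (P : {mpoly A[k]}) : V := \sum_(m <- msupp P) F P@_m m.

(** The support does not behave well under addition; a bound on the degree
    gives a range of summation that a polynomial shares with its summands. *)
Lemma supp_sumwE d P : (msize P <= d)%N ->
  supp_sum P = \sum_(m : 'X_{1..k < d}) F P@_m m.
Proof.
move=> szP; pose I : subFinType _ := 'X_{1..k < d}.
rewrite /supp_sum (big_mksub I) //=; first last.
- by move=> x /msize_mdeg_lt /leq_trans /(_ szP) ->.
- by rewrite msupp_uniq.
by rewrite big_rmcond //= => m /memN_msupp_eq0 ->.
Qed.

Lemma supp_sumD : {morph supp_sum : P Q / P + Q}.
Proof.
move=> P Q; pose d := maxn (msize (P + Q)) (maxn (msize P) (msize Q)).
rewrite !(@supp_sumwE d) ?leq_max ?leqnn ?orbT //.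
by rewrite -big_split; apply: eq_bigr => m _; rewrite mcoeffD FD.
Qed.

Lemma supp_sumX c m : supp_sum (c *: 'X_[m]) = F c m.
Proof.
rewrite /supp_sum; have [->|c0] := eqVneq c 0.
  by rewrite scale0r msupp0 big_nil F0.
by rewrite msuppMCX // big_seq1 mcoeffZ mcoeffX eqxx mulr1.
Qed.
End SupportSums.

Lemma mpoly_additive_eq k (A : comNzRingType) (V : zmodType)
    (f g : {mpoly A[k]} -> V) :
  {morph f : P Q / P + Q} -> {morph g : P Q / P + Q} ->
  (forall c m, f (c *: 'X_[m]) = g (c *: 'X_[m])) -> f =1 g.
Proof.
move=> fD gD e P.
have f0 : f 0 = 0 by apply: (addrI (f 0)); rewrite -fD !addr0.
have g0 : g 0 = 0 by apply: (addrI (g 0)); rewrite -gD !addr0.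
by elim/mpolyind: P => [|c m P _ _ IHP]; rewrite ?f0 ?g0 // fD gD e IHP.
Qed.

Lemma mnm_ind n (Pr : 'X_{1..n} -> Prop) :
  Pr 0%MM -> (forall i a, Pr a -> Pr (U_(i) + a)%MM) -> forall a, Pr a.
Proof.
move=> P0 PS a; move: {2}(mdeg a) (erefl (mdeg a)) => d; elim: d a => [|d IHd] a da.
  by move/eqP: da; rewrite mdeg_eq0 => /eqP ->.
have /existsP[i ai] : [exists i, a i != 0%N].
  apply: contra_eqT da => /existsPn h; rewrite mdegE big1 // => i _.
  by apply/eqP; rewrite -[_ == _]negbK h.
rewrite -(submK (_ : U_(i) <= a)%MM) ?lep1mP // addmC; apply/PS/IHd.
by move: da; rewrite -{1}(submK (_ : U_(i) <= a)%MM) ?lep1mP // mdegD mdeg1 addn1 => -[].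
Qed.

Section Operators.
Variables (n : nat) (A : comNzRingType) (der : 'I_n -> A -> A).
Hypotheses (derD : forall i, {morph der i : a b / a + b})
  (derM : forall i a b, der i (a * b) = der i a * b + a * der i b)
  (derC : forall i j a, der i (der j a) = der j (der i a)).
Local Notation dop := {mpoly A[n]}.
Implicit Types (P Q S : dop) (a b : 'X_{1..n}).
Local Notation "Q \o' P" := (dop_comp der Q P) (at level 50).
Local Notation part := (dop_partial der).

Lemma dop_partialD i : {morph part i : P Q / P + Q}.
Proof.
move=> P Q; rewrite /dop_partial mulrDr.
rewrite -!/(supp_sum (fun c a => der i c *: 'X_[a]) _) supp_sumD; first by rewrite addrACA.
by move=> m c d; rewrite derD scalerDl.
Qed.

Lemma dop_partialX i c a :
  part i (c *: 'X_[a]) = c *: 'X_[U_(i) + a] + der i c *: 'X_[a].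
Proof.
rewrite /dop_partial -scalerAr -mpolyXD; congr (_ + _).
rewrite -/(supp_sum (fun c a => der i c *: 'X_[a]) _) supp_sumX //.
by move=> m d e; rewrite derD scalerDl.
Qed.

Local Opaque dop_partial.

Lemma dop_partialZ i c P : part i (c *: P) = c *: part i P + der i c *: P.
Proof.
move: P; apply: mpoly_additive_eq => [P Q|P Q|d a].
- by rewrite scalerDr dop_partialD.
- by rewrite dop_partialD !scalerDr addrACA.
rewrite scalerA !dop_partialX derM scalerDl scalerDr !scalerA.
by rewrite -!addrA; congr (_ + _); rewrite addrC.
Qed.

Lemma dop_partialC i j P : part i (part j P) = part j (part i P).
Proof.
move: P; apply: mpoly_additive_eq => [P Q|P Q|d a]; try by rewrite !dop_partialD.
rewrite !dop_partialX.
rewrite !dop_partialD !dop_partialX (derC i j) addrACA.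
by rewrite !addmA [(U_(i) + U_(j))%MM]addmC.
Qed.

Let mono_seq (s : seq 'I_n) a P := foldr (fun i => iter (a i) (part i)) P s.

Let mono_seq_comm s a i P : part i (mono_seq s a P) = mono_seq s a (part i P).
Proof.
rewrite /mono_seq; elim: s P => //= j s IHs P; rewrite -IHs.
by elim: (a j) (foldr _ _ _) => //= k IHk Q; rewrite -IHk dop_partialC.
Qed.

Let mono_seqS s a i P : uniq s ->
  mono_seq s (U_(i) + a)%MM P = if i \in s then part i (mono_seq s a P) else mono_seq s a P.
Proof.
elim: s => //= j s IHs /andP[js us]; rewrite {}IHs // inE mnmDE mnm1E.
have [->|ij] := eqVneq i j; first by rewrite (negPf js) add1n.
case: ifP => // _; rewrite add0n.
by elim: (a j) (mono_seq _ _ _) => //= k IHk Q; rewrite IHk dop_partialC.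
Qed.

Lemma dop_mono0 P : dop_mono der 0%MM P = P.
Proof. by rewrite /dop_mono; elim: (enum _) => //= i s ->; rewrite mnm0E. Qed.

(** The order in which the derivations are composed is irrelevant because they
    commute. *)
Lemma dop_monoS i a P : dop_mono der (U_(i) + a)%MM P = part i (dop_mono der a P).
Proof. by have := mono_seqS a i P (enum_uniq 'I_n); rewrite mem_enum. Qed.

Lemma dop_monoD a : {morph dop_mono der a : P Q / P + Q}.
Proof.
move=> P Q; elim/mnm_ind: a => [|i a IHa]; rewrite ?dop_mono0 //.
by rewrite !dop_monoS IHa dop_partialD.
Qed.


Lemma der1 i : der i 1 = 0.
Proof. by apply: (addrI (der i 1)); rewrite addr0 -{3}[1]mulr1 derM mulr1 mul1r. Qed.

Lemma dop_monoX a b : dop_mono der a 'X_[b] = 'X_[a + b].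
Proof.
elim/mnm_ind: a => [|i a IHa]; first by rewrite dop_mono0 add0m.
by rewrite dop_monoS IHa -[X in part i X]scale1r dop_partialX der1 scale0r addr0 scale1r addmA.
Qed.

Let termD P m : {morph (fun c a => c *: dop_mono der a P)^~ m : a b / a + b}.
Proof. by move=> c d; rewrite scalerDl. Qed.

Lemma dop_compDl P : {morph (dop_comp der)^~ P : Q S / Q + S}.
Proof. exact: (supp_sumD (termD P)). Qed.

Lemma dop_compXl c a P : (c *: 'X_[a]) \o' P = c *: dop_mono der a P.
Proof. exact: (supp_sumX (termD P)). Qed.


Lemma dop_compZl c Q P : (c *: Q) \o' P = c *: (Q \o' P).
Proof.
move: Q; apply: mpoly_additive_eq => [Q S|Q S|d a]; rewrite ?(scalerDr, dop_compDl) //.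
by rewrite scalerA !dop_compXl scalerA.
Qed.

Lemma dop_comp_partial i Q P : part i Q \o' P = part i (Q \o' P).
Proof.
move: Q; apply: mpoly_additive_eq => [Q S|Q S|d a].
- by rewrite dop_partialD dop_compDl.
- by rewrite dop_compDl dop_partialD.
by rewrite dop_partialX dop_compDl !dop_compXl dop_partialZ dop_monoS.
Qed.

Lemma dop_comp_mono a Q P : dop_mono der a Q \o' P = dop_mono der a (Q \o' P).
Proof.
elim/mnm_ind: a => [|i a IHa]; first by rewrite !dop_mono0.
by rewrite !dop_monoS dop_comp_partial IHa.
Qed.

(** Left composition with [Q] is [Q] evaluated at the commuting operators
    [dop_partial der i]; associativity says that this evaluation is
    multiplicative, which need only be seen on a derivation and on a
    coefficient. *)
Lemma dop_compA Q P S : Q \o' (P \o' S) = (Q \o' P) \o' S.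
Proof.
move: Q; apply: mpoly_additive_eq => [Q Q'|Q Q'|d a]; rewrite ?dop_compDl //.
by rewrite !dop_compXl dop_compZl dop_comp_mono.
Qed.

Lemma dop_comp1l P : 1 \o' P = P.
Proof. by rewrite -mpolyX0 -[X in X \o' _]scale1r dop_compXl scale1r dop_mono0. Qed.

Lemma dop_comp1r P : P \o' 1 = P.
Proof.
move: P; apply: mpoly_additive_eq => [P Q|P Q|d a] //; first by rewrite dop_compDl.
by rewrite dop_compXl -mpolyX0 dop_monoX addm0.
Qed.


End Operators.

(** * Orders and symbols *)

Section Degrees.
Variables (n : nat) (A : idomainType).
Implicit Types (P Q : {mpoly A[n]}).

Lemma msize_leP P d : reflect (forall m, (d <= mdeg m)%N -> P@_m = 0) (msize P <= d)%N.
Proof.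
apply: (iffP idP) => [szP m dm|h].
  by apply/memN_msupp_eq0/msize_mdeg_ge/(leq_trans szP).
rewrite msizeE; apply/bigmax_leqP_seq => m mP _; rewrite ltnNge; apply/negP => /h /eqP.
by rewrite mcoeff_eq0 mP.
Qed.

Lemma msizeD_leq P Q d : (msize P <= d)%N -> (msize Q <= d)%N -> (msize (P + Q) <= d)%N.
Proof. by move=> hP hQ; apply: leq_trans (mmeasureD_le _ _ _) _; rewrite geq_max hP. Qed.


Lemma msize_sum_leq (I : Type) (r : seq I) (p : pred I) (F : I -> {mpoly A[n]}) d :
  (forall i, p i -> (msize (F i) <= d)%N) -> (msize (\sum_(i <- r | p i) F i) <= d)%N.
Proof.
move=> h; apply: (big_ind (fun P => (msize P <= d)%N)) => //; first by rewrite mmeasure0.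
by move=> *; apply: msizeD_leq.
Qed.

Lemma msizeZ_leq c P d : (msize P <= d)%N -> (msize (c *: P) <= d)%N.
Proof. exact: leq_trans (msizeZ_le _ _). Qed.

Lemma msizeM_leq P Q a b :
  (msize P <= a)%N -> (msize Q <= b.+1)%N -> (msize (P * Q) <= a + b)%N.
Proof.
have [->|P0] := eqVneq P 0; first by rewrite mul0r mmeasure0.
have [->|Q0] := eqVneq Q 0; first by rewrite mulr0 mmeasure0.
move=> hP hQ; rewrite msizeM // -ltnS -addnS prednK; first exact: leq_add.
by rewrite addn_gt0 lt0n mmeasure_poly_eq0 P0.
Qed.

Lemma mcoeff_pihomog d P m :
  (pihomog mdeg d P)@_m = if mdeg m == d then P@_m else 0.
Proof.
rewrite pihomogE raddf_sum /=.
have [mP|mP] := boolP (m \in msupp P).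
  rewrite -big_filter; case: ifP => [md|md].
    rewrite (bigD1_seq m) ?filter_uniq ?msupp_uniq ?mem_filter ?md //=.
    rewrite mcoeffZ mcoeffX eqxx mulr1 big1 ?addr0 // => k /negPf km.
    by rewrite mcoeffZ mcoeffX km mulr0.
  rewrite big1_seq // => k /andP[_]; rewrite mem_filter => /andP[kd _].
  rewrite mcoeffZ mcoeffX; case: eqP => [e|]; rewrite ?mulr0 //.
  by rewrite -e kd in md.
rewrite (memN_msupp_eq0 mP) if_same big1_seq // => k /andP[_ kP].
rewrite mcoeffZ mcoeffX; case: eqP => [e|]; rewrite ?mulr0 //.
by rewrite -e kP in mP.
Qed.

Lemma pihomog_small d P : (msize P <= d)%N -> pihomog mdeg d P = 0.
Proof.
move/msize_leP => h; apply/mpolyP => m; rewrite mcoeff_pihomog mcoeff0.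
by case: eqP => // e; apply: h; rewrite -e.
Qed.

Lemma msize_pihomog d P : (msize (pihomog mdeg d P) <= d.+1)%N.
Proof. by apply/msize_leP => m dm; rewrite mcoeff_pihomog gtn_eqF. Qed.

Lemma msize_pihomogB d P : (msize P <= d.+1)%N -> (msize (P - pihomog mdeg d P)%R <= d)%N.
Proof.
move/msize_leP => h; apply/msize_leP => m; rewrite mcoeffB mcoeff_pihomog.
rewrite leq_eqVlt eq_sym; case: eqP => [_ _|_ /= /h ->]; first exact: subrr.
exact: subrr.
Qed.

Lemma pihomogM P Q a b : (msize P <= a.+1)%N -> (msize Q <= b.+1)%N ->
  pihomog mdeg (a + b) (P * Q) = pihomog mdeg a P * pihomog mdeg b Q.
Proof.
move=> hP hQ; rewrite -[in LHS](subrK (pihomog mdeg a P) P) mulrDl raddfD /=.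
rewrite pihomog_small ?add0r; last by rewrite msizeM_leq // msize_pihomogB.
rewrite -[in LHS](subrK (pihomog mdeg b Q) Q) mulrDr raddfD /=.
rewrite pihomog_small ?add0r; last first.
  by rewrite mulrC addnC msizeM_leq ?msize_pihomogB ?msize_pihomog.
by rewrite pihomog_dE // dhomogM // pihomogP.
Qed.

Section Symbol.
Variable der : 'I_n -> A -> A.
Hypotheses (derD : forall i, {morph der i : a b / a + b})
  (derC : forall i j a, der i (der j a) = der j (der i a)).

Lemma msize_dop_mono_sub a P d : (msize P <= d.+1)%N ->
  (msize (dop_mono der a P - 'X_[a] * P)%R <= mdeg a + d)%N.
Proof.
move=> hP; elim/mnm_ind: a => [|i a IHa].
  by rewrite dop_mono0 mpolyX0 mul1r subrr mmeasure0.
rewrite dop_monoS // mpolyXD mdegD mdeg1 /dop_partial addrAC -mulrA -mulrBr.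
have hX : (msize ('X_[a] * P) <= (mdeg a + d).+1)%N by rewrite -addSn msizeM_leq // msizeX.
have hmono : (msize (dop_mono der a P) <= (mdeg a + d).+1)%N.
  by rewrite -(subrK ('X_[a] * P) (dop_mono _ _ _)) msizeD_leq // (leq_trans IHa).
apply: msizeD_leq.
  by rewrite -addnA addnC (mulrC 'X_i) msizeM_leq // msizeX mdeg1.
rewrite -addnA; apply: (leq_trans _ hmono); rewrite big_seq msize_sum_leq // => m mP.
by rewrite msizeZ_leq // msizeX msize_mdeg_lt.
Qed.

(** Composition agrees with the commutative product up to terms that come from
    derivatives of coefficients, and these have lower order. Hence the symbol
    of a composition is the product of the symbols. *)
Lemma msize_dop_comp_sub Q P a b : (msize Q <= a.+1)%N -> (msize P <= b.+1)%N ->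
  (msize (dop_comp der Q P - Q * P)%R <= a + b)%N.
Proof.
move=> hQ hP; rewrite /dop_comp {3}[Q]mpolyE mulr_suml -sumrB.
rewrite big_seq msize_sum_leq // => m mQ.
rewrite -scalerAl -scalerBr msizeZ_leq // (leq_trans (msize_dop_mono_sub _ hP)) //.
by rewrite leq_add2r -ltnS (leq_trans (msize_mdeg_lt mQ)).
Qed.

Lemma msize_dop_comp Q P a b : (msize Q <= a.+1)%N -> (msize P <= b.+1)%N ->
  (msize (dop_comp der Q P) <= (a + b).+1)%N.
Proof.
move=> hQ hP; rewrite -(subrK (Q * P) (dop_comp _ _ _)) msizeD_leq //.
  by rewrite (leq_trans (msize_dop_comp_sub hQ hP)).
by rewrite -addSn msizeM_leq.
Qed.

Lemma pihomog_dop_comp Q P a b : (msize Q <= a.+1)%N -> (msize P <= b.+1)%N ->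
  pihomog mdeg (a + b) (dop_comp der Q P) = pihomog mdeg a Q * pihomog mdeg b P.
Proof.
move=> hQ hP; rewrite -(subrK (Q * P) (dop_comp _ _ _)) raddfD /= pihomogM //.
by rewrite (pihomog_small (msize_dop_comp_sub hQ hP)) add0r.
Qed.
End Symbol.
End Degrees.

(** * The action of the polynomials in mu on operators *)

Section Action.
Variables (n k : nat) (A : comNzRingType) (der : 'I_n -> A -> A).
Hypotheses (derD : forall i, {morph der i : a b / a + b})
  (derM : forall i a b, der i (a * b) = der i a * b + a * der i b)
  (derC : forall i j a, der i (der j a) = der j (der i a)).
Variable L : 'I_k -> {mpoly A[n]}.
Hypothesis Lcomm : forall i j, dop_comp der (L i) (L j) = dop_comp der (L j) (L i).
Local Notation "Q \o' P" := (dop_comp der Q P) (at level 50).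
Implicit Types (P Q : {mpoly A[n]}) (f g : {mpoly A[k]}) (m : 'X_{1..k}).

Definition dop_monomial m := \big[dop_comp der/1]_(i < k) dop_exp der (L i) (m i).

Let seq_monomial (s : seq 'I_k) m := \big[dop_comp der/1]_(i <- s) dop_exp der (L i) (m i).

Let comp1l P : 1 \o' P = P. Proof. exact: dop_comp1l. Qed.
Let comp1r P : P \o' 1 = P. Proof. exact: dop_comp1r. Qed.
Let compA Q P S : Q \o' (P \o' S) = (Q \o' P) \o' S. Proof. exact: dop_compA. Qed.

Let exp_comm i j e : L i \o' dop_exp der (L j) e = dop_exp der (L j) e \o' L i.
Proof.
elim: e => [|e IHe]; first by rewrite /dop_exp /= comp1l comp1r.
by rewrite /dop_exp /= -/(dop_exp der (L j) e) compA Lcomm -!compA IHe.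
Qed.

Let seq_monomialS s m i : uniq s ->
  seq_monomial s (U_(i) + m)%MM =
  if i \in s then L i \o' seq_monomial s m else seq_monomial s m.
Proof.
rewrite /seq_monomial; elim: s => [|j s IHs]; first by rewrite !big_nil.
rewrite cons_uniq => /andP[js us]; rewrite !big_cons {}IHs // inE mnmDE mnm1E.
have [->|ij] := eqVneq i j.
  by rewrite (negPf js) add1n /= compA.
rewrite add0n /=; case: ifP => // _.
by rewrite compA -exp_comm compA.
Qed.

Lemma dop_monomial0 : dop_monomial 0%MM = 1.
Proof.
rewrite /dop_monomial; elim: (index_enum _) => [|i s IHs]; rewrite ?big_nil //.
by rewrite big_cons IHs mnm0E comp1l.
Qed.

Lemma dop_monomialS i m : dop_monomial (U_(i) + m)%MM = L i \o' dop_monomial m.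
Proof.
have := seq_monomialS m i (index_enum_uniq 'I_k).
by rewrite mem_index_enum.
Qed.

Lemma dop_monomialU i : dop_monomial U_(i)%MM = L i.
Proof. by rewrite -[U_(i)%MM]addm0 dop_monomialS dop_monomial0 comp1r. Qed.

Lemma dop_monomialD m m' : dop_monomial (m + m')%MM = dop_monomial m \o' dop_monomial m'.
Proof.
elim/mnm_ind: m => [|i m IHm]; first by rewrite add0m dop_monomial0 comp1l.
by rewrite -addmA !dop_monomialS IHm compA.
Qed.

(** Right compositions with the [L i] commute with each other and with
    multiplication by scalars on the left, so that the operators become a module
    over the polynomials in [mu]. *)
Definition dop_act f P := \sum_(m <- msupp f) f@_m *: (P \o' dop_monomial m).

Let act_termD P m : {morph (fun c m => c *: (P \o' dop_monomial m))^~ m : a b / a + b}.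
Proof. by move=> a b; rewrite scalerDl. Qed.

Lemma dop_actDl P : {morph dop_act^~ P : f g / f + g}.
Proof. exact: (supp_sumD (act_termD P)). Qed.

Lemma dop_actX c m P : dop_act (c *: 'X_[m]) P = c *: (P \o' dop_monomial m).
Proof. exact: (supp_sumX (act_termD P)). Qed.

Lemma dop_actDr f : {morph dop_act f : P Q / P + Q}.
Proof.
move=> P Q; rewrite /dop_act -big_split; apply: eq_bigr => m _.
by rewrite dop_compDl scalerDr.
Qed.

Lemma dop_act0l P : dop_act 0 P = 0.
Proof. by rewrite /dop_act msupp0 big_nil. Qed.

Lemma dop_act0r f : dop_act f 0 = 0.
Proof. by apply: (addrI (dop_act f 0)); rewrite -dop_actDr !addr0. Qed.


Lemma dop_actM f g P : dop_act (f * g) P = dop_act f (dop_act g P).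
Proof.
move: f; apply: mpoly_additive_eq => [f f'|f f'|c m]; rewrite ?mulrDl ?dop_actDl //.
move: g; apply: mpoly_additive_eq => [g g'|g g'|d m'].
- by rewrite mulrDr dop_actDl.
- by rewrite dop_actDl dop_actDr.
rewrite -scalerAl -scalerAr scalerA -mpolyXD !dop_actX dop_compZl // scalerA.
by rewrite addmC dop_monomialD compA.
Qed.

Lemma dop_actC c P : dop_act c%:MP P = c *: P.
Proof. by rewrite -[c%:MP]mulr1 mul_mpolyC -mpolyX0 dop_actX dop_monomial0 comp1r. Qed.

Lemma dop_act1 P : dop_act 1 P = P.
Proof. by rewrite -mpolyC1 dop_actC scale1r. Qed.

Lemma dop_actXU i P : dop_act 'X_i P = P \o' L i.
Proof. by rewrite -[X in dop_act X _]scale1r dop_actX scale1r dop_monomialU. Qed.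


Lemma dop_evalE f : dop_eval der f L = dop_act f 1.
Proof. by apply: eq_bigr => m _; rewrite comp1l. Qed.

Lemma muderivD i : {morph @muderiv n k A der i : f g / f + g}.
Proof.
apply: (supp_sumD (F := fun c m => der i c *: 'X_[m])) => m a b.
by rewrite derD scalerDl.
Qed.

Lemma muderivX i c m : muderiv der i (c *: 'X_[m] : {mpoly A[k]}) = der i c *: 'X_[m].
Proof.
apply: (supp_sumX (F := fun c m => der i c *: 'X_[m])) => m' a b.
by rewrite derD scalerDl.
Qed.

Lemma muderivC i j f : muderiv der i (muderiv der j f) = muderiv der j (muderiv der i f).
Proof.
move: f; apply: mpoly_additive_eq => [f g|f g|c m]; try by rewrite !muderivD.
by rewrite !muderivX derC.
Qed.


Lemma dop_partial_act i f P :
  dop_partial der i (dop_act f P) = dop_act f (dop_partial der i P) + dop_act (muderiv der i f) P.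
Proof.
move: f; apply: mpoly_additive_eq => [f g|f g|c m].
- by rewrite dop_actDl dop_partialD.
- by rewrite muderivD !dop_actDl addrACA.
by rewrite muderivX !dop_actX dop_partialZ // dop_comp_partial.
Qed.

(** The quotient of the operators over [A[mu]] by the left ideal that the
    [L i - mu_i] generate: each [mu_i] is moved to the right and replaced by
    [L i]. *)
Definition eval_shifted (G : {mpoly {mpoly A[k]}[n]}) : {mpoly A[n]} :=
  \sum_(a <- msupp G) dop_act G@_a 'X_[a].

Let eval_termD a : {morph (fun c a => dop_act c 'X_[a])^~ a : f g / f + g}.
Proof. exact: dop_actDl. Qed.

Lemma eval_shiftedD : {morph eval_shifted : G H / G + H}.
Proof. exact: (supp_sumD eval_termD). Qed.

Lemma eval_shiftedX c a : eval_shifted (c *: 'X_[a]) = dop_act c 'X_[a].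
Proof. exact: (supp_sumX eval_termD). Qed.

Lemma eval_shiftedZ c G : eval_shifted (c *: G) = dop_act c (eval_shifted G).
Proof.
move: G; apply: mpoly_additive_eq => [G H|G H|d a].
- by rewrite scalerDr eval_shiftedD.
- by rewrite eval_shiftedD dop_actDr.
by rewrite scalerA !eval_shiftedX dop_actM.
Qed.

Lemma eval_shifted0 : eval_shifted 0 = 0.
Proof. by rewrite /eval_shifted msupp0 big_nil. Qed.

Lemma eval_shifted_partial i G :
  eval_shifted (dop_partial (muderiv der) i G) = dop_partial der i (eval_shifted G).
Proof.
move: G; apply: mpoly_additive_eq => [G H|G H|c a].
- by rewrite (dop_partialD muderivD); apply: eval_shiftedD.
- by rewrite eval_shiftedD dop_partialD.
rewrite (dop_partialX muderivD) (eval_shiftedD (c *: 'X_[_]) (_ *: 'X_[_])).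
have eX := eval_shiftedX.
apply: etrans (congr2 +%R (eX c (U_(i) + a)%MM) (eX (muderiv der i c) a)) _.
rewrite (eval_shiftedX c a) dop_partial_act; congr (dop_act _ _ + _).
rewrite -[X in dop_partial _ _ X]scale1r dop_partialX // scale1r.
by rewrite der1 // scale0r addr0.
Qed.

Lemma eval_shifted_mono a G :
  eval_shifted (dop_mono (muderiv der) a G) = dop_mono der a (eval_shifted G).
Proof.
elim/mnm_ind: a => [|i a IHa]; first by rewrite !dop_mono0.
by rewrite !dop_monoS ?eval_shifted_partial ?IHa //; [apply: muderivD | apply: muderivC].
Qed.
End Action.

(** * Maximal minors of the resultant matrix *)

Lemma msize_dop_order n (A : comNzRingType) (P : {mpoly A[n]}) :
  (msize P <= (dop_order P).+1)%N.
Proof. by rewrite /dop_order; case: (msize P). Qed.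

Lemma nat_pigeonhole (I : finType) (a l : I -> nat) :
  (\sum_i l i < \sum_i a i + #|I|)%N -> exists i, (l i <= a i)%N.
Proof.
move=> h; apply/existsP; apply: contraTT h => /existsPn h; rewrite -leqNgt.
rewrite -sum1_card -big_split /=; apply: leq_sum => i _.
by rewrite addn1 ltnNge; apply: h.
Qed.

(** Cramer's rule: a row of the adjugate of the square submatrix expresses the
    minor, placed in the column [k], as a combination of rows. *)
Lemma maximal_minor_row_space (A : comNzRingType) r c (M : 'M[A]_(r, c)) d k :
  (c <= r)%N -> maximal_minor M d -> exists u : 'rV_r, u *m M = d *: delta_mx 0 k.
Proof.
move=> cr; rewrite /maximal_minor (minn_idPr cr) => -[f [g [_ homg ->]]].
have injg : injective g.
  move=> i j gij; have [/homg|/homg|/val_inj //] := ltngtP i j.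
    by rewrite gij ltnn.
  by rewrite gij ltnn.
set B := mxsub f g M.
(* The columns are permuted by [g], and [h] undoes the permutation. *)
have [h gK hK] := injF_bij injg.
exists (\sum_i (\adj B) (h k) i *: delta_mx 0 (f i)).
apply/rowP => j; rewrite mulmx_suml summxE.
have -> : \sum_i ((\adj B) (h k) i *: (delta_mx 0 (f i) : 'rV_r) *m M) 0 j =
    (\adj B *m B) (h k) (h j).
  rewrite [RHS]mxE; apply: eq_bigr => i _.
  by rewrite -scalemxAl -rowE !mxE hK.
rewrite mul_adj_mx !mxE eqxx /= (can_eq hK) eq_sym.
by case: eqP => _; rewrite ?mulr1n ?mulr0n ?mulr1 ?mulr0.
Qed.

Section Resultant.
Variables (n : nat) (K : fieldType) (der : 'I_n -> K -> K).
Hypotheses (derD : forall i, {morph der i : a b / a + b})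
  (derM : forall i a b, der i (a * b) = der i a * b + a * der i b)
  (derC : forall i j a, der i (der j a) = der j (der i a)).
Variable L : 'I_n.+1 -> {mpoly K[n]}.
Hypothesis Lcomm : forall i j, dop_comp der (L i) (L j) = dop_comp der (L j) (L i).
Hypothesis Lorder : forall i j : 'I_n.+1, i != j -> (0 < dop_order (L i) + dop_order (L j))%N.

Local Notation N := (res_order L).
Local Notation M := (res_matrix der L).
Local Notation Kmu := {mpoly K[n.+1]}.
Local Notation act := (dop_act der L).

Lemma order_zero_unique i j : dop_order (L i) = 0%N -> dop_order (L j) = 0%N -> i = j.
Proof.
by move=> li lj; apply/eqP; apply: contraT => /Lorder; rewrite li lj.
Qed.

Lemma res_orderE : (N + n = \sum_i dop_order (L i))%N.
Proof.
rewrite /res_order subnK //.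
have [/existsP[i0 /eqP li0]|/existsPn pos] := boolP [exists i, dop_order (L i) == 0%N].
  rewrite (bigD1 i0) //= li0 add0n.
  apply: (@leq_trans (\sum_(i | i != i0) 1)%N).
    by rewrite sum1_card cardC1 card_ord.
  apply: leq_sum => i ni; rewrite lt0n; apply: contra ni => /eqP li.
  by rewrite (order_zero_unique li li0).
apply: (@leq_trans (\sum_(i < n.+1) 1)%N); first by rewrite sum1_card card_ord.
by apply: leq_sum => i _; rewrite lt0n pos.
Qed.

Lemma mcoeff_shifted i a :
  (shifted_dop L i)@_a = ((L i)@_a)%:MP - (if a == 0%MM then 'X_i else 0).
Proof.
rewrite /shifted_dop mcoeffB mcoeffC; congr (_ - _); last first.
  by case: eqP; rewrite ?mulr1 ?mulr0.
pose F (c : K) b : {mpoly Kmu[n]} := c%:MP *: 'X_[b].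
have FD b : {morph F^~ b : c d / c + d} by move=> c d; rewrite /F mpolyCD scalerDl.
rewrite -[X in mcoeff _ X]/(supp_sum F (L i)).
move: (L i); apply: mpoly_additive_eq => [P Q|P Q|c b].
- by rewrite (supp_sumD FD) mcoeffD.
- by rewrite mcoeffD mpolyCD.
rewrite (supp_sumX FD) /F !mcoeffZ !mcoeffX.
by case: eqP; rewrite ?mulr1 ?mulr0.
Qed.

Lemma msize_shifted i : (msize (shifted_dop L i) <= (dop_order (L i)).+1)%N.
Proof.
apply/msize_leP => a lta; rewrite mcoeff_shifted.
rewrite memN_msupp_eq0 ?sub0r; last first.
  by rewrite msize_mdeg_ge // (leq_trans (msize_dop_order _)).
case: eqP lta => [->|_ _]; last by rewrite oppr0.
by rewrite mdeg0.
Qed.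

Lemma eval_shifted_dop i : eval_shifted der L (shifted_dop L i) = 0.
Proof.
have evB := eval_shiftedD der L.
have e0 : eval_shifted der L 0 = 0 by apply: eval_shifted0.
rewrite /shifted_dop -[- _]mulN1r.
have -> : -1 * ('X_i)%:MP = (- 'X_i) *: 'X_[0%MM] :> {mpoly Kmu[n]}.
  by rewrite mpolyX0 mulN1r scaleNr alg_mpolyC.
rewrite evB (eval_shiftedX _ _ (- 'X_i)).
rewrite (big_morph _ evB e0) (_ : \sum_(a <- _) _ = L i); last first.
  rewrite [RHS]mpolyE; apply: eq_bigr => a _.
  by rewrite eval_shiftedX dop_actC.
have aN : act (- 'X_i) 1 = - act 'X_i 1.
  by apply: (addrI (act 'X_i 1)); rewrite -dop_actDl subrr dop_act0l subrr.
by rewrite mpolyX0 aN dop_actXU // dop_comp1l // subrr.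
Qed.

(** Derivations on the left pass through [eval_shifted], so the left ideal
    generated by [L i - mu_i] is killed along with its generator. *)
Lemma eval_shifted_row a i :
  eval_shifted der L (dop_comp (muderiv der) 'X_[a] (shifted_dop L i)) = 0.
Proof.
rewrite -[X in dop_comp _ X _]scale1r dop_compXl scale1r.
rewrite eval_shifted_mono // eval_shifted_dop.
have mono0 : dop_mono der a 0 + dop_mono der a 0 = dop_mono der a 0.
  by rewrite -dop_monoD // addr0.
by apply: (addrI (dop_mono der a 0)); rewrite mono0 addr0.
Qed.

(** A monomial of degree at most [N], made homogeneous of degree [N] by a slack
    variable, has [n + 1] exponents of sum [N], while the orders have the sum
    [N + n]: some exponent reaches the corresponding order. Dividing by that
    power gives the row matched with the column. *)
Lemma res_matrix_cols_leq : (#|{: 'X_{1..n < N.+1}}| <= #|{: res_row L}|)%N.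
Proof.
(* The slack variable has the index [ord0]. *)
pose shift (i : 'I_n.+1) : 'X_{1..n} :=
  if unlift ord0 i is Some j then (U_(j) *+ dop_order (L i))%MM else 0%MM.
have rowP (a : 'X_{1..n < N.+1}) :
    exists r : res_row L, bmnm a = (bmnm (tagged r) + shift (tag r))%MM.
  have := bmdeg a; rewrite ltnS => aN.
  pose e (i : 'I_n.+1) := if unlift ord0 i is Some j then a j else (N - mdeg a)%N.
  have eN : (\sum_i e i = N)%N.
    rewrite big_ord_recl {1}/e unlift_none (eq_bigr a).
      by rewrite -mdegE subnK.
    by move=> j _; rewrite /e liftK.
  have [|i li] := @nat_pigeonhole _ e (fun i => dop_order (L i)).
    by rewrite eN -res_orderE card_ord addnS ltnS.
  have sa : (shift i <= a)%MM.
    move: li; rewrite /shift /e; case: unlift => [j lj|_]; apply/mnm_lepP => k.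
      by rewrite mulmnE mnm1E; case: eqP => [<-|_]; rewrite ?mul1n ?mul0n.
    by rewrite mnm0E.
  have aE : (bmnm a = a - shift i + shift i)%MM by rewrite submK.
  have bP : (mdeg (a - shift i)%MM < N.+1 - dop_order (L i))%N.
    rewrite ltn_subRL addnC.
    have := congr1 mdeg aE; rewrite mdegD; move: li; rewrite /shift /e.
    case: unlift => [j lj|lN].
      by rewrite mdegMn mdeg1 mul1n ltnS => <-.
    by rewrite mdeg0 addn0 ltnS => <-; rewrite -leq_subRL // subKn // leq_subr.
  by exists (Tagged (fun i => 'X_{1..n < N.+1 - dop_order (L i)}) (BMultinom bP)).
pose f a := projT1 (cid (rowP a)).
have fE a : bmnm a = (bmnm (tagged (f a)) + shift (tag (f a)))%MM := projT2 (cid (rowP a)).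
apply: (@leq_card _ _ f) => a b fab; apply/val_inj.
by rewrite /= (fE a) (fE b) fab.
Qed.

Local Notation cols := #|{: 'X_{1..n < N.+1}}|.
Local Notation rows := #|{: res_row L}|.

Definition row_op (r : 'I_rows) : {mpoly Kmu[n]} :=
  dop_comp (muderiv der) 'X_[bmnm (tagged (enum_val r))] (shifted_dop L (tag (enum_val r))).

Lemma res_matrixE r j : M r j = (row_op r)@_(enum_val j).
Proof. by rewrite /res_matrix mxE [LHS]mxE. Qed.

Lemma row_order (r : 'I_rows) :
  (mdeg (bmnm (tagged (enum_val r))) + dop_order (L (tag (enum_val r))) <= N)%N.
Proof.
by have := bmdeg (tagged (enum_val r)); rewrite ltn_subRL addnC ltnS.
Qed.

Lemma row_op_symbol r : (msize (row_op r - 'X_[bmnm (tagged (enum_val r))]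
  * shifted_dop L (tag (enum_val r)))%R <= N)%N.
Proof.
apply: leq_trans (row_order r); apply: msize_dop_comp_sub.
- exact: muderivD.
- exact: muderivC.
- by rewrite msizeX.
exact: msize_shifted.
Qed.

Lemma msize_row_op r : (msize (row_op r) <= N.+1)%N.
Proof.
pose a := bmnm (tagged (enum_val r)); pose i := tag (enum_val r).
rewrite -(subrK ('X_[a] * shifted_dop L i) (row_op r)).
apply: msizeD_leq; first exact: leq_trans (row_op_symbol r) _.
apply: leq_trans (_ : _ <= (mdeg a + dop_order (L i)).+1)%N _.
  by rewrite -addSn msizeM_leq ?msizeX ?msize_shifted.
by rewrite ltnS row_order.
Qed.

(** Cramer's rule for the column of the monomial [1] puts the operator [d] of
    order zero into the left ideal generated by the [L i - mu_i]. *)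
Lemma maximal_minor_act d : maximal_minor M d -> act d 1 = 0.
Proof.
pose a0 : 'X_{1..n < N.+1} := BMultinom (bm0_proof n N).
move/(maximal_minor_row_space (enum_rank a0) res_matrix_cols_leq) => [u uM].
have dE : \sum_r u 0 r *: row_op r = d *: 'X_[0%MM].
  apply/mpolyP => a; rewrite raddf_sum mcoeffZ mcoeffX /=.
  have [aN|aN] := ltnP (mdeg a) N.+1; last first.
    rewrite big1 => [|r _]; first by case: eqP aN => [<-|_]; rewrite ?mdeg0 ?mulr0.
    by rewrite mcoeffZ (elimT (msize_leP _ _) (msize_row_op r)) ?mulr0.
  have := congr1 (fun v : 'rV_cols => v 0 (enum_rank (BMultinom aN))) uM.
  rewrite !mxE eqxx (inj_eq enum_rank_inj) eq_sym => e.
  rewrite (eq_bigr (fun r => u 0 r * M r (enum_rank (BMultinom aN)))) => [|r _].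
    by rewrite e.
  by rewrite mcoeffZ res_matrixE enum_rankK.
have := congr1 (eval_shifted der L) dE; rewrite eval_shiftedX mpolyX0 => <-.
rewrite (big_morph _ (eval_shiftedD der L) (eval_shifted0 der L)) big1 // => r _.
by rewrite eval_shiftedZ // eval_shifted_row dop_act0r.
Qed.

Definition symbol i : {mpoly K[n]} := pihomog mdeg (dop_order (L i)) (L i).

(** In the terms of projective geometry, this forces the symbols of positive
    degree to have no common zero. *)
Definition symbols_fill := forall a : 'X_{1..n}, mdeg a = N ->
  exists g : 'I_n.+1 -> {mpoly K[n]},
    [/\ forall i, (msize (g i) <= N.+1 - dop_order (L i))%N,
        forall i, dop_order (L i) = 0%N -> g i = 0
      & 'X_[a] = \sum_i g i * symbol i].

Let mon (r : 'I_rows) : 'X_{1..n} := bmnm (tagged (enum_val r)).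
Let cmon (j : 'I_cols) : 'X_{1..n} := bmnm (enum_val j).
Let idx (r : 'I_rows) : 'I_n.+1 := tag (enum_val r).

(** In degree [N] a row of the resultant matrix that comes from an operator of
    positive order is free of [mu]: it is zero or the product of a monomial and
    a symbol. The entries of the other rows in degree [N] are multiples of some
    [L i - mu_i]. If the rows of the first kind do not span degree [N] over [K],
    some nonzero vector [v] over [K] is orthogonal to them; modulo [z] it is
    then orthogonal to all rows, and Cramer's rule makes [z] divide every
    maximal minor. *)
Lemma symbols_fill_or_divides z :
  (forall i, dop_order (L i) = 0%N -> divides z (((L i)@_0%MM)%:MP - 'X_i)) ->
  symbols_fill \/ (forall d, maximal_minor M d -> divides z d).
Proof.
move=> zP; have [fill|nfill] := EM symbols_fill; [by left | right].
have [a0 a0N na0] : exists2 a0 : 'X_{1..n}, mdeg a0 = N &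
  ~ exists g : 'I_n.+1 -> {mpoly K[n]},
    [/\ forall i, (msize (g i) <= N.+1 - dop_order (L i))%N,
        forall i, dop_order (L i) = 0%N -> g i = 0
      & 'X_[a0] = \sum_i g i * symbol i].
  apply: contrapT => h; apply: nfill => a aN; apply: contrapT => na; apply: h.
  by exists a.
have a0lt : (mdeg a0 < N.+1)%N by rewrite a0N.
pose j0 : 'I_cols := enum_rank (BMultinom a0lt).
have j0E : cmon j0 = a0 by rewrite /cmon enum_rankK.
pose T : 'M[K]_(rows, cols) := \matrix_(r, j)
  if (mdeg (cmon j) == N) && (0 < dop_order (L (idx r)))%N
  then ('X_[mon r] * L (idx r))@_(cmon j) else 0.
have nT : ~~ ((delta_mx 0 j0 : 'rV_cols) <= T)%MS.
  apply/negP => /submxP[D eT]; apply: na0.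
  (* Only the rows of order exactly [N] contribute in degree [N]. *)
  pose c r := if (mdeg (mon r) + dop_order (L (idx r)) == N)%N &&
    (0 < dop_order (L (idx r)))%N then D 0 r else 0.
  exists (fun i => \sum_(r | idx r == i) c r *: 'X_[mon r]); split=> [i|i li|].
  - apply: msize_sum_leq => r /eqP <-; apply: msizeZ_leq.
    by rewrite msizeX ltn_subRL addnC ltnS row_order.
  - by rewrite big1 // => r /eqP ri; rewrite /c ri li andbF scale0r.
  have -> : \sum_i (\sum_(r | idx r == i) c r *: 'X_[mon r]) * symbol i =
      \sum_r c r *: ('X_[mon r] * symbol (idx r)).
    rewrite [RHS](partition_big idx predT) //=; apply: eq_bigr => i _.
    by rewrite mulr_suml; apply: eq_bigr => r /eqP ->; rewrite scalerAl.
  apply/mpolyP => a; rewrite raddf_sum mcoeffX /=.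
  have [aN|aN] := eqVneq (mdeg a) N; last first.
    rewrite big1 => [|r _]; first by case: (a0 =P a) aN => // <-; rewrite a0N eqxx.
    rewrite mcoeffZ /c; case: ifP => [/andP[/eqP rN _]|]; last by rewrite mul0r.
    have hom : 'X_[mon r] * symbol (idx r) \is N.-homog.
      by rewrite -rN dhomogM ?dhomogX ?pihomogP.
    by rewrite -(pihomog_dE hom) mcoeff_pihomog (negPf aN) mulr0.
  have alt : (mdeg a < N.+1)%N by rewrite aN.
  pose j : 'I_cols := enum_rank (BMultinom alt).
  have jE : cmon j = a by rewrite /cmon enum_rankK.
  have := congr1 (fun v : 'rV_cols => v 0 j) eT.
  rewrite !mxE eqxx (inj_eq enum_rank_inj) eq_sym => e.
  rewrite [LHS](e : (a0 == a)%:R = _).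
  apply: eq_bigr => r _; rewrite mxE jE aN eqxx /= mcoeffZ /c.
  have [l0|lpos] := posnP (dop_order (L (idx r))); first by rewrite andbF mulr0 mul0r.
  rewrite andbT.
  have -> : ('X_[mon r] * L (idx r))@_a = ('X_[mon r] * symbol (idx r))@_a.
    apply/eqP; rewrite -subr_eq0 -mcoeffB -mulrBr; apply/eqP.
    apply: (elimT (msize_leP _ N)); last by rewrite aN.
    apply: leq_trans (row_order r); rewrite mulrC addnC msizeM_leq ?msizeX //.
    by rewrite msize_pihomogB // msize_dop_order.
  case: ifP => // /negbT rN; rewrite mul0r (elimT (msize_leP _ N)) ?mulr0 ?aN //.
  have := row_order r; rewrite leq_eqVlt (negPf rN) /=; apply: leq_trans.
  by rewrite -addSn msizeM_leq ?msizeX // msize_pihomog.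
rewrite submxE in nT.
have [q vq] : exists q, (cokermx T) j0 q != 0.
  apply/existsP; apply: contraNT nT => /existsPn h; apply/eqP/rowP => q.
  by rewrite -rowE [LHS]mxE [RHS]mxE; apply/eqP; have := h q; rewrite negbK.
pose v j := if mdeg (cmon j) == N then (cokermx T) j q else 0.
have Tv r : \sum_j T r j * v j = 0.
  have := congr1 (fun B : 'M_(rows, cols) => B r q) (mulmx_coker T).
  rewrite [LHS]mxE [RHS]mxE => e; rewrite -[RHS]e; apply: eq_bigr => j _; rewrite /v.
  by case: ifP => // jN; rewrite mxE jN /= mulr0 mul0r.
have coefXM (R : comNzRingType) (b a : 'X_{1..n}) (P : {mpoly R[n]}) :
    ('X_[b] * P)@_a = if (b <= a)%MM then P@_(a - b) else 0.
  case: ifP => [ba|nba].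
    by rewrite mulrC -[X in mcoeff X _](submK ba) addmC mcoeffMX.
  apply/eqP; rewrite mulrC mcoeff_eq0; apply/negP; rewrite (perm_mem (msuppMX _ _)).
  by case/mapP => m _ e; rewrite e lem_addr in nba.
have Mv r : divides z (\sum_j M r j * (v j)%:MP).
  have [l0|lpos] := posnP (dop_order (L (idx r))).
    apply: divides_sum => j _; rewrite /v; case: ifP => [/eqP jN|]; last first.
      by rewrite mpolyC0 mulr0 => _; apply: divides0.
    apply: divides_mulr; rewrite res_matrixE -/(cmon j).
    set a := cmon j in jN *.
    have -> : (row_op r)@_a = ('X_[mon r] * shifted_dop L (idx r))@_a.
      apply/eqP; rewrite -subr_eq0 -mcoeffB; apply/eqP.
      by apply: (elimT (msize_leP _ N)) (row_op_symbol r) _ _; rewrite jN.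
    rewrite coefXM; case: ifP => _; last exact: divides0.
    rewrite mcoeff_shifted; case: eqP => [->|/eqP ne0]; first exact: zP.
    rewrite subr0 (elimT (msize_leP _ 1)) ?mpolyC0; first exact: divides0.
      by rewrite -l0 msize_dop_order.
    by rewrite lt0n mdeg_eq0.
  rewrite (eq_bigr (fun j => (T r j * v j)%:MP)) => [|j _].
    by rewrite -raddf_sum Tv raddf0; apply: divides0.
  rewrite mpolyCM /v; case: ifP => [/eqP jN|]; last by rewrite !mpolyC0 !mulr0.
  congr (_ * _); rewrite res_matrixE mxE jN eqxx lpos /= -/(cmon j).
  set a := cmon j in jN *.
  have -> : (row_op r)@_a = ('X_[mon r] * shifted_dop L (idx r))@_a.
    apply/eqP; rewrite -subr_eq0 -mcoeffB; apply/eqP.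
    by apply: (elimT (msize_leP _ N)) (row_op_symbol r) _ _; rewrite jN.
  rewrite !coefXM; case: ifP => [ba|]; last by rewrite mpolyC0.
  rewrite mcoeff_shifted; case: eqP => [e|]; last by rewrite subr0.
  have := row_order r; rewrite -/(mon r) -/(idx r) -jN -/a -(submK ba) e add0m.
  by rewrite -{2}[mdeg (mon r)]addn0 leq_add2l leqn0 -[X in X == _]prednK.
move=> d /(maximal_minor_row_space j0 res_matrix_cols_leq) [u uM].
have : divides z (\sum_r u 0 r * \sum_j M r j * (v j)%:MP).
  by apply: divides_sum => r _; apply: divides_mull.
have -> : \sum_r u 0 r * \sum_j M r j * (v j)%:MP = d * (v j0)%:MP.
  under eq_bigr do rewrite mulr_sumr; rewrite exchange_big /=.
  rewrite (eq_bigr (fun j => (u *m M) 0 j * (v j)%:MP)) => [|j _]; last first.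
    by rewrite mxE mulr_suml; apply: eq_bigr => r _; rewrite mulrA.
  rewrite uM (bigD1 j0) //= big1 ?addr0 => [|j /negPf jj].
    by rewrite !mxE !eqxx mulr1.
  by rewrite !mxE eqxx jj mulr0 mul0r.
rewrite /v j0E a0N eqxx => /(divides_mulr ((cokermx T j0 q)^-1)%:MP).
by rewrite -mulrA -mpolyCM mulfV // mpolyC1 mulr1.
Qed.
End Resultant.

(** * Dimension counts *)

Lemma card_bmultinom k m : #|{: 'X_{1..k < m.+1}}| = 'C(k + m, k).
Proof.
rewrite -card_partial_ord_partitions.
pose f (a : 'X_{1..k < m.+1}) : k.-tuple 'I_m.+1 := [tuple inord (bmnm a i) | i < k].
have le (a : 'X_{1..k < m.+1}) i : (bmnm a i < m.+1)%N.
  apply: leq_ltn_trans (bmdeg a); rewrite mdegE (bigD1 i) //=; exact: leq_addr.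
have fE a i : val (tnth (f a) i) = bmnm a i by rewrite tnth_mktuple /= inordK.
have injf : injective f.
  move=> a b ab; apply/val_inj/mnmP => i.
  by rewrite /= -!fE ab.
rewrite -(card_imset _ injf); apply: eq_card => t; rewrite inE.
apply/imsetP/idP => [[a _ ->]|tm].
  rewrite big_tuple (eq_bigr (bmnm a)) => [|i _]; last by rewrite -fE.
  by rewrite -mdegE -ltnS; apply: bmdeg.
have tP : (mdeg [multinom (tnth t i : nat) | i < k] < m.+1)%N.
  rewrite mdegE ltnS; apply: leq_trans tm; rewrite big_tuple leq_eqVlt; apply/orP; left.
  by apply/eqP/eq_bigr => i _; rewrite mnmE.
exists (BMultinom tP) => //; apply: eq_from_tnth => i.
by apply/val_inj; rewrite fE /= mnmE.
Qed.

Section CoefVectors.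
Variable K : fieldType.

Definition coef_row k W (P : {mpoly K[k]}) : 'rV[K]_#|{: 'X_{1..k < W}}| :=
  \row_j P@_(bmnm (enum_val j)).

Definition row_poly k W (v : 'rV[K]_#|{: 'X_{1..k < W}}|) : {mpoly K[k]} :=
  \sum_j v 0 j *: 'X_[bmnm (enum_val j)].

Lemma coef_rowD k W : {morph @coef_row k W : P Q / P + Q}.
Proof. by move=> P Q; apply/rowP => j; rewrite !mxE mcoeffD. Qed.

Lemma coef_rowZ k W c (P : {mpoly K[k]}) : coef_row W (c *: P) = c *: coef_row W P.
Proof. by apply/rowP => j; rewrite !mxE mcoeffZ. Qed.

Lemma coef_row0 k W : coef_row W (0 : {mpoly K[k]}) = 0.
Proof. by apply/rowP => j; rewrite !mxE mcoeff0. Qed.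

Lemma coef_row_sum k W (I : Type) (r : seq I) (p : pred I) (F : I -> {mpoly K[k]}) :
  coef_row W (\sum_(i <- r | p i) F i) = \sum_(i <- r | p i) coef_row W (F i).
Proof. by apply: (big_morph _ (@coef_rowD k W)); apply: coef_row0. Qed.

Lemma row_polyK k W : cancel (@row_poly k W) (@coef_row k W).
Proof.
move=> v; apply/rowP => j; rewrite mxE /row_poly raddf_sum /= (bigD1 j) //=.
rewrite mcoeffZ mcoeffX eqxx mulr1 big1 ?addr0 // => i ij.
rewrite mcoeffZ mcoeffX; case: eqP => [/val_inj /enum_val_inj e|]; rewrite ?mulr0 //.
by rewrite e eqxx in ij.
Qed.

Lemma coef_rowK k W (P : {mpoly K[k]}) : (msize P <= W)%N -> row_poly (coef_row W P) = P.
Proof.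
move=> szP; rewrite [RHS](mpolywE szP) /row_poly.
rewrite (reindex (fun j : 'I_#|{: 'X_{1..k < W}}| => enum_val j)) /=; last first.
  by exists enum_rank => j _; rewrite ?enum_valK ?enum_rankK.
by apply: eq_bigr => j _; rewrite mxE.
Qed.

Lemma coef_row_inj k W (P Q : {mpoly K[k]}) :
  (msize P <= W)%N -> (msize Q <= W)%N -> coef_row W P = coef_row W Q -> P = Q.
Proof. by move=> hP hQ e; rewrite -(coef_rowK hP) e coef_rowK. Qed.

Lemma msize_row_poly k W (v : 'rV_#|{: 'X_{1..k < W}}|) : (msize (row_poly v) <= W)%N.
Proof.
apply: msize_sum_leq => j _; apply: msizeZ_leq; rewrite msizeX; exact: bmdeg.
Qed.

(** Truncation of degrees at both ends makes all dimensions finite. *)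
Definition lin_coef k k' W W' (phi : {mpoly K[k]} -> {mpoly K[k']}) :
    'M[K]_(#|{: 'X_{1..k < W}}|, #|{: 'X_{1..k' < W'}}|) :=
  \matrix_i coef_row W' (phi 'X_[bmnm (enum_val i)]).

Section LinCoef.
Variables (k k' : nat) (phi : {mpoly K[k]} -> {mpoly K[k']}).
Hypotheses (phiD : {morph phi : P Q / P + Q})
  (phiZ : forall c P, phi (c *: P) = c *: phi P).

Lemma mul_lin_coef W W' (v : 'rV_#|{: 'X_{1..k < W}}|) :
  v *m lin_coef W W' phi = coef_row W' (phi (row_poly v)).
Proof.
have phi0 : phi 0 = 0 by apply: (addrI (phi 0)); rewrite -phiD !addr0.
rewrite mulmx_sum_row (big_morph phi phiD phi0) coef_row_sum.
by apply: eq_bigr => j _; rewrite phiZ coef_rowZ rowK.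
Qed.
End LinCoef.

Lemma row_lin_coef k k' W W' (phi : {mpoly K[k]} -> {mpoly K[k']}) i :
  row i (lin_coef W W' phi) = coef_row W' (phi 'X_[bmnm (enum_val i)]).
Proof. by rewrite rowK. Qed.
End CoefVectors.

(** The kernel of [phi] contains the multiples of [p] and those of [q]. Since
    [p] is prime and does not divide [q], the relations [p * f + q * g = 0] are
    the multiples of the obvious one, so that the dimension of the sum of the
    two spaces of multiples is known exactly. *)
Lemma rank_coprime_quotient (K : fieldType) k k' W m
    (phi : {mpoly K[k]} -> {mpoly K[k']}) (p q : {mpoly K[k]}) :
  {morph phi : P Q / P + Q} -> (forall c P, phi (c *: P) = c *: phi P) ->
  prime_elt p -> ~ divides p q ->
  (forall f, phi (p * f) = 0) -> (forall f, phi (q * f) = 0) ->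
  let a := (msize p).-1 in let b := (msize q).-1 in (a + b <= m)%N ->
  (\rank (lin_coef m.+1 W phi) + 'C(k + (m - a), k) + 'C(k + (m - b), k)
     <= 'C(k + m, k) + 'C(k + (m - (a + b)), k))%N.
Proof.
move=> phiD phiZ [p0 _ pM] pq php phq a b abm.
have q0 : q != 0 by apply: contra_notN pq => /eqP ->; apply: divides0.
have sp : msize p = a.+1 by rewrite /a prednK // lt0n mmeasure_poly_eq0.
have sq : msize q = b.+1 by rewrite /b prednK // lt0n mmeasure_poly_eq0.
have mulD (r : {mpoly K[k]}) : {morph *%R r : P Q / P + Q} by move=> P Q; rewrite mulrDr.
have mulZ (r : {mpoly K[k]}) c P : r * (c *: P) = c *: (r * P) by rewrite scalerAr.
pose A := lin_coef (m - a).+1 m.+1 ( *%R p).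
pose B := lin_coef (m - b).+1 m.+1 ( *%R q).
pose C := lin_coef m.+1 W phi.
have kill c (r : {mpoly K[k]}) : (msize r <= c.+1)%N -> (c <= m)%N ->
    (forall f, phi (r * f) = 0) -> lin_coef (m - c).+1 m.+1 ( *%R r) *m C = 0.
  move=> sr cm phr; apply/row_matrixP => i.
  rewrite row_mul row_lin_coef mul_lin_coef // row0 coef_rowK ?phr ?coef_row0 //.
  have iN := bmdeg (enum_val i).
  apply: leq_trans (msizeM_leq (b := mdeg (enum_val i)) sr _) _; first by rewrite msizeX.
  by lia.
have AB0 : col_mx A B *m C = 0.
  by rewrite mul_col_mx !kill ?col_mx0 ?sp ?sq //; lia.
rewrite -!card_bmultinom.
have := mulmx0_rank_max AB0; have := mxrank_ker (col_mx A B).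
have := rank_leq_row (col_mx A B).
suff : (\rank (kermx (col_mx A B)) <= #|{: 'X_{1..k < (m - (a + b)).+1}}|)%N.
  by rewrite -/C; lia.
(* The rows of [E] are the multiples of the relation [p * (- q) + q * p = 0]. *)
pose E := row_mx (lin_coef (m - (a + b)).+1 (m - a).+1 ( *%R (- q)))
  (lin_coef (m - (a + b)).+1 (m - b).+1 ( *%R p)).
apply: leq_trans (rank_leq_row E); apply: mxrankS.
apply/row_subP => i; set v := row i _.
have : v *m col_mx A B = 0 by rewrite /v -row_mul mulmx_ker row0.
rewrite -(hsubmxK v); move: (lsubmx v) (rsubmx v) => x y {v}.
rewrite mul_row_col !mul_lin_coef // -coef_rowD.
pose f := row_poly x; pose g := row_poly y; rewrite -/f -/g => e.
have sf : (msize f <= (m - a).+1)%N by apply: msize_row_poly.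
have sg : (msize g <= (m - b).+1)%N by apply: msize_row_poly.
have {}e : p * f + q * g = 0.
  apply: (@coef_row_inj _ _ m.+1); rewrite ?mmeasure0 ?coef_row0 //.
  apply: msizeD_leq.
    by apply: leq_trans (msizeM_leq (leqnn _) sf) _; rewrite sp; lia.
  by apply: leq_trans (msizeM_leq (leqnn _) sg) _; rewrite sq; lia.
have : divides p (q * g).
  by exists (- f); rewrite mulNr [f * p]mulrC; apply/eqP; rewrite -addr_eq0 addrC e.
case/pM => // -[h gE].
have fE : f = - q * h.
  apply: (mulfI p0); apply/eqP; rewrite -subr_eq0 -e gE; apply/eqP; ring.
have sh : (msize h <= (m - (a + b)).+1)%N.
  have [->|h0] := eqVneq h 0; first by rewrite mmeasure0.
  by move: sg; rewrite gE msizeM // sp; lia.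
apply/submxP; exists (coef_row (m - (a + b)).+1 h).
rewrite mul_mx_row !mul_lin_coef //; rewrite coef_rowK // -fE mulrC -gE.
by rewrite !row_polyK.
Qed.

(** In a linear relation between the [P i], the terms of maximal order give a
    relation between the [h * s i], and [h] can be cancelled: independent
    symbols come from independent operators. *)
Lemma rank_symbols_leq (K : fieldType) k W W' (r : nat) (s P : 'I_r -> {mpoly K[k]})
    (h : {mpoly K[k]}) (E : nat) (w : 'I_r -> nat) :
  h != 0 -> (forall i, (msize (P i) <= (E + w i).+1)%N) ->
  (forall i, pihomog mdeg (E + w i) (P i) = h * s i) ->
  (forall i, (msize (s i) <= W)%N) -> (forall i, (msize (P i) <= W')%N) ->
  (\rank (\matrix_i coef_row W (s i)) <= \rank (\matrix_i coef_row W' (P i)))%N.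
Proof.
move=> h0 szP hcP szs szP'; set S := \matrix_i _; set T := \matrix_i _.
pose f := maxrankfun S.
have freeS : row_free (rowsub f S) by apply: maxrowsub_free.
suff freeT : row_free (rowsub f T).
  by rewrite -(eqP freeT); apply: mxrankS; apply: rowsub_sub.
apply: inj_row_free => v vT.
have {}vT : \sum_i v 0 i *: P (f i) = 0.
  apply: (@coef_row_inj _ _ W'); rewrite ?mmeasure0 //.
    by apply: msize_sum_leq => i _; apply: msizeZ_leq.
  rewrite coef_row0 -vT mulmx_sum_row coef_row_sum; apply: eq_bigr => i _.
  by rewrite coef_rowZ row_rowsub rowK.
apply/eqP; apply: contraT => v0.
have [i0 vi0] : exists i, v 0 i != 0.
  apply/existsP; apply: contraNT v0 => /existsPn vz; apply/eqP/rowP => i.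
  by rewrite mxE; apply/eqP; rewrite -[_ == _]negbK vz.
case: (@arg_maxnP _ i0 (fun i => v 0 i != 0) (fun i => w (f i)) vi0) => j vj jmax.
have := congr1 (pihomog mdeg (E + w (f j))) vT; rewrite raddf0 raddf_sum /=.
rewrite (bigID (fun i => w (f i) == w (f j))) /= [X in _ + X]big1 ?addr0 => [|i wi].
  rewrite (eq_bigr (fun i => h * (v 0 i *: s (f i)))) => [|i /eqP wi].
    rewrite -mulr_sumr => /eqP; rewrite mulf_eq0 (negPf h0) /= => /eqP ss.
    pose v' := \row_i (if w (f i) == w (f j) then v 0 i else 0).
    have : v' *m rowsub f S = 0 *m rowsub f S.
      rewrite mul0mx mulmx_sum_row -[RHS](coef_row0 K k W) -ss coef_row_sum.
      rewrite [RHS]big_mkcond; apply: eq_bigr => i _.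
      by rewrite mxE row_rowsub rowK; case: ifP => _; rewrite ?coef_rowZ ?scale0r.
    move/(row_free_inj freeS) => /(congr1 (fun u : 'rV_(\rank S) => u 0 j)).
    by rewrite !mxE eqxx => vj0; rewrite vj0 eqxx in vj.
  by rewrite linearZ /= -wi hcP scalerAr.
have [vi|vi] := eqVneq (v 0 i) 0; first by rewrite vi scale0r raddf0.
rewrite linearZ /= pihomog_small ?scaler0 //.
apply: leq_trans (szP _) _; rewrite -addnS leq_add2l ltn_neqAle wi.
exact: jmax.
Qed.

(** The polynomials of degree at most [m] lie in the sum, over the monomials of
    degree less than [N], of the images of [ev] multiplied by that monomial;
    each summand has at most the rank of [ev]. *)
Lemma rank_span_geq (K : fieldType) n k N W m (ev : {mpoly K[k]} -> {mpoly K[n]}) :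
  {morph ev : P Q / P + Q} -> (forall c P, ev (c *: P) = c *: ev P) ->
  (forall i, (msize (ev 'X_[bmnm (i : 'X_{1..k < m.+1})]) <= W)%N) ->
  (forall a : 'X_{1..n}, (mdeg a <= m)%N -> exists u : 'X_{1..n < N} -> {mpoly K[k]},
    (forall b, (msize (u b) <= m.+1)%N) /\ 'X_[a] = \sum_b 'X_[bmnm b] * ev (u b)) ->
  ('C(n + m, n) <= #|{: 'X_{1..n < N}}| * \rank (lin_coef m.+1 W ev))%N.
Proof.
move=> evD evZ szev span.
have mulD (r : {mpoly K[n]}) : {morph *%R r : P Q / P + Q} by move=> P Q; rewrite mulrDr.
have mulZ (r : {mpoly K[n]}) c P : r * (c *: P) = c *: (r * P) by rewrite scalerAr.
pose G := lin_coef m.+1 W ev.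
pose H (b : 'X_{1..n < N}) := G *m lin_coef W m.+1 ( *%R 'X_[bmnm b]).
have szev' (u : {mpoly K[k]}) : (msize u <= m.+1)%N -> (msize (ev u) <= W)%N.
  have ev0 : ev 0 = 0 by apply: (addrI (ev 0)); rewrite -evD !addr0.
  move=> /mpolywE ->; rewrite (big_morph ev evD ev0).
  by apply: msize_sum_leq => i _; rewrite evZ; apply: msizeZ_leq.
have one : ((1%:M : 'M[K]_#|{: 'X_{1..n < m.+1}}|) <= \sum_b <<H b>>)%MS.
  apply/row_subP => i.
  have am : (mdeg (enum_val i) <= m)%N by rewrite -ltnS; apply: bmdeg.
  have [u [szu aE]] := span _ am.
  have -> : row i 1%:M = \sum_b coef_row m.+1 (u b) *m H b.
    rewrite (_ : row i 1%:M = coef_row m.+1 'X_[bmnm (enum_val i)]).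
      rewrite aE coef_row_sum; apply: eq_bigr => b _.
      by rewrite mulmxA !mul_lin_coef // !coef_rowK // ?szev'.
    apply/rowP => j; rewrite !mxE mcoeffX; congr (_ %:R); congr nat_of_bool.
    by apply/eqP/eqP => [->|/val_inj /enum_val_inj].
  apply: summx_sub_sums => b _; rewrite genmxE; exact: submxMl.
rewrite -card_bmultinom; move: (mxrankS one); rewrite mxrank1 => /leq_trans; apply.
have sum_le (s : seq 'X_{1..n < N}) : (\rank (\sum_(b <- s) <<H b>>)%MS <= size s * \rank G)%N.
  elim: s => [|b s IHs]; first by rewrite big_nil mxrank0.
  rewrite big_cons /= mulSn; apply: leq_trans (mxrank_adds_leqif _ _) _.
  by apply: leq_add IHs; rewrite genmxE mxrankM_maxl.
apply: leq_trans (sum_le _) _.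
by rewrite leq_mul2r [X in (_ <= X)%N]cardT enumT leqnn orbT.
Qed.

(** Used with binomial coefficients for [H], [G] and [F]: second differences of
    a polynomial of degree [k + 2] are bounded by one of degree [k]. *)
Lemma second_difference_leq (H G F : nat -> nat) m a b y :
  (forall x, H x.+1 = H x + G x.+1)%N -> (forall x, G x.+1 = G x + F x.+1)%N ->
  {homo F : x y / (x <= y)%N} -> (m + a + b <= y)%N ->
  (H (m + a + b) + H m <= H (m + a) + H (m + b) + a * (b * F y))%N.
Proof.
move=> HS GS Fle; elim: a => [|a IHa] le_y; first by rewrite addn0 mul0n addn0 addnC.
have G_leq x d : (x + d <= y)%N -> (G (x + d) <= G x + d * F y)%N.
  elim: d => [|d IHd] xy; first by rewrite addn0 mul0n addn0.
  rewrite addnS in xy *; rewrite GS mulSn.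
  by have := IHd (ltnW xy); have := Fle _ _ xy; lia.
have := G_leq (m + a.+1)%N b le_y.
rewrite addnS addSn in le_y *; have := IHa (ltnW le_y).
by rewrite !HS mulSn; lia.
Qed.

(** * Growth of the submodule generated by an operator *)

Section Growth.
Variables (n : nat) (K : fieldType) (der : 'I_n.+1 -> K -> K).
Hypotheses (derD : forall i, {morph der i : a b / a + b})
  (derM : forall i a b, der i (a * b) = der i a * b + a * der i b)
  (derC : forall i j a, der i (der j a) = der j (der i a)).
Variable L : 'I_n.+2 -> {mpoly K[n.+1]}.
Hypothesis Lcomm : forall i j, dop_comp der (L i) (L j) = dop_comp der (L j) (L i).
Local Notation act := (dop_act der L).
Local Notation N := (res_order L).
Local Notation Kmu := {mpoly K[n.+2]}.

Definition eval_symbols (f : Kmu) : {mpoly K[n.+1]} := mmap (@mpolyC n.+1 K) (symbol L) f.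

Lemma eval_symbolsD : {morph eval_symbols : f g / f + g}.
Proof. exact: mmapD. Qed.

Lemma eval_symbolsZ c f : eval_symbols (c *: f) = c *: eval_symbols f.
Proof. by rewrite /eval_symbols mmapZ mul_mpolyC. Qed.

Lemma eval_symbolsM f g : eval_symbols (f * g) = eval_symbols f * eval_symbols g.
Proof. exact: rmorphM. Qed.

Lemma eval_symbolsU i : eval_symbols 'X_i = symbol L i.
Proof. by rewrite /eval_symbols mmapX mmap1U. Qed.

Lemma eval_symbols1 : eval_symbols 1 = 1.
Proof. exact: rmorph1. Qed.

Definition weight (m : 'X_{1..n.+2}) := (\sum_i m i * dop_order (L i))%N.

Lemma weightS i m : weight (U_(i) + m)%MM = (weight m + dop_order (L i))%N.
Proof.
rewrite /weight (eq_bigr (fun j => (i == j) * dop_order (L j) + m j * dop_order (L j))%N).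
  rewrite big_split /= addnC; congr addn.
  rewrite (bigD1 i) //= eqxx mul1n big1 ?addn0 // => j ji.
  by rewrite eq_sym (negPf ji).
by move=> j _; rewrite mnmDE mnm1E mulnDl.
Qed.

Lemma act_symbol e E m : (msize e <= E.+1)%N ->
  (msize (act 'X_[m] e) <= (E + weight m).+1)%N /\
  pihomog mdeg (E + weight m) (act 'X_[m] e) = pihomog mdeg E e * eval_symbols 'X_[m].
Proof.
move=> sze; elim/mnm_ind: m => [|i m [IHs IHh]].
  rewrite mpolyX0 dop_act1 // eval_symbols1 mulr1 /weight big1 ?addn0 //.
  by move=> i _; rewrite mnm0E.
rewrite mpolyXD dop_actM // dop_actXU // weightS addnA.
split; first by apply: msize_dop_comp => //; apply: msize_dop_order.
rewrite pihomog_dop_comp ?msize_dop_order // IHh eval_symbolsM eval_symbolsU.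
by rewrite -mulrA [_ * symbol L i]mulrC.
Qed.

Lemma submonomial_deg (a : 'X_{1..n.+1}) d : (d <= mdeg a)%N ->
  exists2 b : 'X_{1..n.+1}, mdeg b = d & (b <= a)%MM.
Proof.
elim: d => [|d IHd] da.
  by exists 0%MM; rewrite ?mdeg0 //; apply/mnm_lepP => i; rewrite mnm0E.
have [b bd ba] := IHd (ltnW da).
have /existsP[i lti] : [exists i, b i < a i]%N.
  apply: contraTT da => /existsPn h; rewrite -leqNgt -bd !mdegE.
  by apply: leq_sum => i _; rewrite leqNgt.
exists (U_(i) + b)%MM; first by rewrite mdegD mdeg1 bd.
apply/mnm_lepP => j; rewrite mnmDE mnm1E.
by have [<-|_] := eqVneq i j; [rewrite add1n | move/mnm_lepP: ba; apply].
Qed.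

Let spanned d (P : {mpoly K[n.+1]}) :=
  exists u : 'X_{1..n.+1 < N} -> Kmu,
    (forall b, (msize (u b) <= d)%N) /\ P = \sum_b 'X_[bmnm b] * eval_symbols (u b).

Let ev0 : eval_symbols 0 = 0. Proof. exact: rmorph0. Qed.

Let spannedD d P Q : spanned d P -> spanned d Q -> spanned d (P + Q).
Proof.
move=> [u [su ->]] [v [sv ->]]; exists (fun b => u b + v b); split.
  by move=> b; apply: msizeD_leq.
by rewrite -big_split; apply: eq_bigr => b _; rewrite eval_symbolsD mulrDr.
Qed.

Let spanned0 d : spanned d 0.
Proof.
exists (fun=> 0); split=> [b|]; first by rewrite mmeasure0.
by rewrite big1 // => b _; rewrite ev0 mulr0.
Qed.

Let spanned_sum d (I : Type) (r : seq I) (F : I -> {mpoly K[n.+1]}) :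
  (forall i, spanned d (F i)) -> spanned d (\sum_(i <- r) F i).
Proof.
move=> h; apply: (big_ind (spanned d)) => //; exact: spannedD.
Qed.

Let spannedZ d c P : spanned d P -> spanned d (c *: P).
Proof.
move=> [u [su ->]]; exists (fun b => c *: u b); split.
  by move=> b; apply: msizeZ_leq.
by rewrite scaler_sumr; apply: eq_bigr => b _; rewrite eval_symbolsZ scalerAr.
Qed.

Let spanned_leq d d' P : (d <= d')%N -> spanned d P -> spanned d' P.
Proof. by move=> dd [u [su ->]]; exists u; split=> // b; apply: leq_trans dd. Qed.

Let spanned_symbol d P i : spanned d P -> spanned d.+1 (P * symbol L i).
Proof.
move=> [u [su ->]]; exists (fun b => u b * 'X_i); split.
  move=> b; apply: leq_trans (msizeM_leq (b := 1) (su b) _) _; last by rewrite addn1.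
  by rewrite msizeX mdeg1.
by rewrite mulr_suml; apply: eq_bigr => b _; rewrite eval_symbolsM eval_symbolsU mulrA.
Qed.

(** A monomial of degree at least [N] is divisible by one of degree [N], hence
    by [symbols_fill] a combination of products of a symbol of positive degree
    with a monomial of smaller degree: at each step the degree in [mu] grows by
    one and that in [xi] drops by at least one. *)
Lemma spanned_monomial (a : 'X_{1..n.+1}) : symbols_fill L ->
  exists u : 'X_{1..n.+1 < N} -> Kmu,
    (forall b, (msize (u b) <= (mdeg a).+1)%N) /\
    'X_[a] = \sum_b 'X_[bmnm b] * eval_symbols (u b).
Proof.
move=> fill; rewrite -/(spanned (mdeg a).+1 'X_[a]).
have [d] := ubnP (mdeg a); elim: d a => // d IHd a; rewrite ltnS => ad.
have [aN|aN] := ltnP (mdeg a) N.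
  exists (fun b => (b == BMultinom aN)%:R); split=> [b|].
    by case: eqP => _; rewrite ?mmeasure0 // msize1.
  rewrite (bigD1 (BMultinom aN)) //= eqxx eval_symbols1 mulr1 big1 ?addr0 // => b.
  by move/negPf ->; rewrite ev0 mulr0.
have [a0 a0N a0a] := submonomial_deg aN.
have [g [sg g0 a0E]] := fill a0 a0N.
rewrite -(submK a0a) mpolyXD a0E mulr_sumr; apply: spanned_sum => i.
rewrite (mpolyE (g i)) [X in 'X_[_] * X]mulr_suml mulr_sumr big_seq.
apply: (big_ind (spanned _)); [exact: spanned0 | exact: spannedD | move=> b bg].
rewrite -scalerAl -scalerAr mulrA -mpolyXD; apply: spannedZ.
have lpos : (0 < dop_order (L i))%N.
  rewrite lt0n; apply/negP => /eqP /g0 gi0.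
  by rewrite gi0 msupp0 in bg.
have lt : (mdeg (a - a0 + b)%MM < mdeg (a - a0 + a0)%MM)%N.
  rewrite !mdegD ltn_add2l a0N.
  by have := leq_trans (msize_mdeg_lt bg) (sg i); lia.
apply: spanned_leq (spanned_symbol _ (IHd _ _)); first exact: lt.
by apply: leq_trans lt _; rewrite submK.
Qed.

Lemma dop_actCA f g P : act f (act g P) = act g (act f P).
Proof. by rewrite -!dop_actM // mulrC. Qed.

(** In degree at most [m], the submodule generated by [e] has dimension at
    least ['C(n.+1 + m, n.+1) / c] because [e] is nonzero, where [c] is the
    number of monomials of degree less than [N], and at most
    [a * b * 'C(n + m, n)] because [p] and [q] annihilate [e], where [a] and
    [b] are their degrees. The first bound has the larger degree in [m]. *)
Lemma coprime_annihilators_absurd e p q : symbols_fill L -> e != 0 ->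
  prime_elt p -> ~ divides p q -> act p e = 0 -> act q e = 0 -> False.
Proof.
move=> fill e0 pP pq pe qe.
pose a := (msize p).-1; pose b := (msize q).-1.
pose c := #|{: 'X_{1..n.+1 < N}}|.
(* The quotient of ['C(n.+1 + m, n.+1)] by ['C(n + m, n)] is
   [(n.+1 + m) / n.+1], which exceeds [c * (a * b)] as soon as [m0 <= m]. *)
pose m0 := (n.+1 * (c * (a * b)))%N; pose m := (m0 + a + b)%N.
pose mon (i : 'I_#|{: 'X_{1..n.+2 < m.+1}}|) : 'X_{1..n.+2} := bmnm (enum_val i).
pose W := (\max_i msize (eval_symbols 'X_[mon i]))%N.
pose W' := (\max_i msize (act 'X_[mon i] e))%N.
have rank_geq : ('C(n.+1 + m, n.+1) <= c * \rank (lin_coef m.+1 W eval_symbols))%N.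
  apply: rank_span_geq eval_symbolsD eval_symbolsZ _ _ => [i|x xm].
    have := @leq_bigmax _ (fun i => msize (eval_symbols 'X_[mon i])) (enum_rank i).
    by rewrite /mon enum_rankK.
  have [u [su xE]] := spanned_monomial x fill; exists u; split=> // y.
  by apply: leq_trans (su y) _.
have rank_le : (\rank (lin_coef m.+1 W eval_symbols) <=
    \rank (lin_coef m.+1 W' (act^~ e)))%N.
  have es i := act_symbol (mon i) (msize_dop_order e).
  apply: (@rank_symbols_leq _ _ _ _ _ _ _ (pihomog mdeg (dop_order e) e)
    (dop_order e) (fun i => weight (mon i))) => [|i|i|i|i].
  - apply: contra e0 => /eqP hc; rewrite -mleadc_eq0.
    have <- : (pihomog mdeg (dop_order e) e)@_(mlead e) = e@_(mlead e).
      rewrite mcoeff_pihomog /dop_order; have [->|ne] := eqVneq e 0.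
        by rewrite mcoeff0 if_same.
      by rewrite -mlead_deg // eqxx.
    by rewrite hc mcoeff0.
  - by case: (es i).
  - by case: (es i).
  - exact: (@leq_bigmax _ (fun i => msize (eval_symbols 'X_[mon i])) i).
  exact: (@leq_bigmax _ (fun i => msize (act 'X_[mon i] e)) i).
have kill r f : act r e = 0 -> act (r * f) e = 0.
  by move=> re; rewrite mulrC dop_actM // re dop_act0r.
have abm : (a + b <= m)%N by rewrite /m -addnA leq_addl.
have actZ s f : act (s *: f) e = s *: act f e.
  by rewrite -mul_mpolyC dop_actM // dop_actC.
have := rank_coprime_quotient W' (dop_actDl der L e) actZ pP pq
  (fun f => kill p f pe) (fun f => kill q f qe) abm.
have -> : (m - a = m0 + b)%N by rewrite /m; lia.
have -> : (m - b = m0 + a)%N by rewrite /m; lia.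
have -> : (m - (a + b) = m0)%N by rewrite /m; lia.
have step k x : 'C(k.+1 + x.+1, k.+1) = ('C(k.+1 + x, k.+1) + 'C(k + x.+1, k))%N.
  by rewrite addnS binS addSnnS.
have binle : {homo (fun x => 'C(n + x, n)) : x y / (x <= y)%N}.
  by move=> x y xy; apply: leq_bin2l; rewrite leq_add2l.
have := @second_difference_leq _ _ _ m0 a b m (step n.+1) (step n) binle (leqnn _).
rewrite /= -/m -/a -/b => diff quot.
have rank_small : (\rank (lin_coef m.+1 W' (act^~ e)) <= a * (b * 'C(n + m, n)))%N.
  rewrite -(leq_add2r ('C(n.+2 + (m0 + b), n.+2) + 'C(n.+2 + (m0 + a), n.+2))).
  rewrite addnA (leq_trans quot) // (leq_trans diff) // addnC.
  by rewrite [X in (_ + X <= _)%N]addnC.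
have Cle : ('C(n.+1 + m, n.+1) <= c * (a * (b * 'C(n + m, n))))%N.
  apply: leq_trans rank_geq _; rewrite leq_mul2l (leq_trans rank_le rank_small).
  by rewrite orbT.
have Cpos : (0 < 'C(n + m, n))%N by rewrite bin_gt0 leq_addr.
have : ((n.+1 + m) * 'C(n + m, n) <= m0 * 'C(n + m, n))%N.
  rewrite (mul_bin_diag (n.+1 + m) n) /m0 -!mulnA.
  by rewrite leq_mul2l.
by rewrite leq_pmul2r // /m; lia.
Qed.

(** Multiply [e] by the prime factors one after the other: the last nonzero
    product is annihilated by the next prime. *)
Lemma prime_annihilator s u e : u \is a GRing.unit -> (forall p, p \in s -> prime_elt p) ->
  e != 0 -> act (u * \prod_(p <- s) p) e = 0 ->
  exists p g, [/\ prime_elt p, act g e != 0 & act p (act g e) = 0].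
Proof.
move=> uu; elim: s => [|p s IHs] sP e0.
  rewrite big_nil mulr1 => ue; case/eqP: e0.
  have <- : act 1 e = e by apply: dop_act1.
  by rewrite -(mulVr uu) dop_actM // ue dop_act0r.
rewrite big_cons mulrCA dop_actM // => pe.
have [e1|e1] := eqVneq (act (u * \prod_(j <- s) j) e) 0.
  by apply: IHs => // r rs; apply: sP; rewrite inE rs orbT.
by exists p, (u * \prod_(j <- s) j); split=> //; apply: sP; rewrite mem_head.
Qed.

Hypothesis Lorder : forall i j : 'I_n.+2, i != j -> (0 < dop_order (L i) + dop_order (L j))%N.

(** If the symbols do not fill degree [N], a polynomial [z] that annihilates
    [1] divides all maximal minors, hence [p]. If they do and [p] does not
    annihilate [1], a factorization of a cofactor of [p] leads to the situation
    of [coprime_annihilators_absurd]. *)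
Theorem mu_shifted_resultant_act p : mu_shifted_resultant der L p -> act p 1 = 0.
Proof.
move=> [p_div p_great].
have [z [zP z1]] : exists z : Kmu,
    (forall i, dop_order (L i) = 0%N -> divides z (((L i)@_0%MM)%:MP - 'X_i)) /\ act z 1 = 0.
  have [[i li]|npos] := EM (exists i, dop_order (L i) = 0%N); last first.
    by exists 0; split=> [i li|]; [case: npos; exists i | apply: dop_act0l].
  exists (((L i)@_0%MM)%:MP - 'X_i); split=> [j lj|].
    by rewrite (order_zero_unique Lorder lj li); apply: divides_refl.
  have LiE : L i = ((L i)@_0%MM)%:MP.
    by apply: msize1_polyC; rewrite -li; apply: msize_dop_order.
  apply: (addIr (act 'X_i 1)); rewrite -dop_actDl subrK add0r dop_actXU //.
  by rewrite dop_comp1l // dop_actC // alg_mpolyC -LiE.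
(* With [z = 0] the next alternative says that all maximal minors vanish. *)
have [fill|z_minor] := symbols_fill_or_divides derD derC Lorder zP; last first.
  by have [q ->] := p_great z z_minor; rewrite dop_actM // z1 dop_act0r.
apply/eqP; apply: contraT => e0.
have [d dM d0] : exists2 d, maximal_minor (res_matrix der L) d & d != 0.
  apply: contrapT => h; case/eqP: e0.
  have [|q ->] := p_great 0; last by rewrite mulr0 dop_act0l.
  move=> d dM; have [->|d0] := eqVneq d 0; first exact: divides_refl.
  by case: h; exists d.
have minor_e d' q : maximal_minor (res_matrix der L) d' -> d' = q * p -> act q (act p 1) = 0.
  by move=> d'M d'E; rewrite -dop_actM // -d'E maximal_minor_act.
have [q dE] := p_div d dM.
have q0 : q != 0 by apply: contraNneq d0 => q0; rewrite dE q0 mul0r.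
have [s [sP [u uu qE]]] := factorial_mpoly q0.
have := minor_e d q dM dE; rewrite qE => qe.
have [r [g [rP ge re]]] := prime_annihilator uu sP e0 qe.
have [r0 ru _] := rP.
(* Otherwise [r * p] would be a common divisor of the maximal minors. *)
have [d' [d'M [q' d'E rq']]] : exists d', maximal_minor (res_matrix der L) d' /\
    exists2 q', d' = q' * p & ~ divides r q'.
  apply: contrapT => h; case/negP: ru; apply/unitrPr.
  have p0 : p != 0 by apply: contraNneq d0 => p0; rewrite dE p0 mulr0.
  have [|q' pE] := p_great (r * p).
    move=> d' d'M; have [q' d'E] := p_div d' d'M.
    have [[v vE]|rq'] := EM (divides r q').
      by exists v; rewrite d'E vE mulrA.
    by case: h; exists d'; split=> //; exists q'.
  exists q'; apply: (mulIf p0); rewrite mul1r [RHS]pE; ring.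
have := coprime_annihilators_absurd fill ge rP rq' re.
by case; rewrite dop_actCA (minor_e d' q') // dop_act0r.
Qed.
End Growth.

Theorem theorem3p1 (R : realType) (n : nat) (hn : (1 <= n)%N)
    (L : 'I_n.+1 -> {mpoly (ratfun R[i] n)[n]})
    (Lorder : forall i j : 'I_n.+1,
       i != j -> (0 < dop_order (L i) + dop_order (L j))%N)
    (Lcomm : forall i j : 'I_n.+1,
       dop_comp (@ratderiv R[i] n) (L i) (L j)
       = dop_comp (@ratderiv R[i] n) (L j) (L i))
    (p : {mpoly (ratfun R[i] n)[n.+1]})
    (hp : mu_shifted_resultant (@ratderiv R[i] n) L p) :
  dop_eval (@ratderiv R[i] n) p L = 0.
Proof.
case: n hn L Lorder Lcomm p hp => // n _ L Lorder Lcomm p hp.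
have dD := @ratderivD R[i] n.+1; have dM := @ratderivM R[i] n.+1.
have dC := @ratderivC R[i] n.+1.
rewrite dop_evalE //.
exact: mu_shifted_resultant_act.
Qed.
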